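(* Let $d\ge 2$ be an integer and let $\beta\in\mathbb{C}$ satisfy $\beta^d=1$, $\beta\neq 1$. Let $(k,m)\in\mathbb{N}\times\mathbb{N}^*$ and let $\mu\in\mathbb{C}$ be an eigenvalue of the Koch map $G_{k,m}\colon\mathbb{C}^{k+m-1}\to\mathbb{C}^{k+m-1}$ at a fixed point $z$ of $G_{k,m}$, i.e. an eigenvalue of the differential $D_zG_{k,m}$. Then either $\mu=0$ or $|\mu|>1$.
   Context: $\mathbb{N}=\{0,1,2,\dots\}$ and $\mathbb{N}^*=\{1,2,\dots\}$. The maps $G_{k,m}\colon\mathbb{C}^{k+m-1}\to\mathbb{C}^{k+m-1}$ (depending also on $d$ and $\beta$) are defined, with the convention $x_0:=0$, as follows. If $k=0$: $G_{0,m}(x_1,\dots,x_{m-1})=(-x_{m-1}^d,\;x_1^d-x_{m-1}^d,\;\dots,\;x_{m-2}^d-x_{m-1}^d)$ (that is, the $i$-th coordinate is $x_{i-1}^d-x_{m-1}^d$ for $1\le i\le m-1$; for $m=1$ the space is $\mathbb{C}^0$ and there are no eigenvalues). If $k\ge 1$: the $i$-th coordinate of $G_{k,m}(x_1,\dots,x_{k+m-1})$ is $\left(x_{i-1}-\frac{\beta x_{k+m-1}-x_{k-1}}{\beta-1}\right)^d$ for $1\le i\le k+m-1$. *)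

(* Defs.v *)
From HB Require Import structures.
From mathcomp Require Import all_boot all_algebra.

Set Implicit Arguments.
Unset Strict Implicit.
Unset Printing Implicit Defensive.

Import GRing.Theory.

Local Open Scope ring_scope.

(* 1-based coordinates with the convention x_0 = 0: [xcoord x i] is x_i for
   1 <= i <= n.  The value 0 for i > n is never used by [koch] when m >= 1. *)
Definition xcoord (K : nmodType) (n : nat) (x : 'rV[K]_n) (i : nat) : K :=
  if i is j.+1 then (if insub j is Some o then x 0 o else 0) else 0.

(* The entry of index i : 'I_(k + m - 1) is the (i + 1)-st coordinate of
   G_{k,m}, hence it involves x_i, the predecessor of x_{i+1}.  For k = 0 and
   i = 0 it is x_0 ^ d - x_{m-1} ^ d = - x_{m-1} ^ d since d > 0. *)
Definition koch (K : fieldType) (d : nat) (beta : K) (k m : nat)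
    (x : 'rV[K]_(k + m - 1)) : 'rV[K]_(k + m - 1) :=
  if k == 0%N then
    \row_(i < k + m - 1) (xcoord x i ^+ d - xcoord x (m - 1) ^+ d)
  else
    \row_(i < k + m - 1)
      (xcoord x i
       - (beta * xcoord x (k + m - 1) - xcoord x (k - 1)) / (beta - 1)) ^+ d.

(* Main.v *)
Require Import Defs.
From HB Require Import structures.
From mathcomp Require Import all_boot all_order all_algebra.
From mathcomp Require Import complex ring lra zify.
From mathcomp Require Import all_classical all_reals all_analysis.
Import Order.TTheory GRing.Theory Num.Theory.
Import numFieldNormedType.Exports.
Local Open Scope ring_scope.
Local Open Scope complex_scope.

(** A fixed point of [koch] is the orbit of the critical point of a polynomial of
    degree [d] that has only one. Put this critical point at the origin: the orbit is
    [u 0 = 0], [u (i + 1) = u i ^ d + u 1], it closes up by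
    [u k = beta * u (k + m)], and an eigenvector of eigenvalue [mu] becomes a family
    of tangent vectors [w i] with [w 0 = 0],
    [mu * (w (i + 1) - w 1) = d * u i ^ (d - 1) * w i] and
    [w k = beta * w (k + m)]. Suppose [mu] is not 0. Two independent arguments give
    [|mu| >= 1] and [|mu| <> 1].

    The first one is analytic. Move the points [u i] holomorphically over the unit
    disc, with velocities [tau * w i]. Such a motion can be pulled back by the
    polynomials: the new [u i] is the [d]-th root of the difference of the old
    [u (i + 1)] and [u 1], which exists on the whole disc because distinct points
    stay distinct. The pull-back is a motion over the same disc, its velocities
    are [tau / mu * w i], and taking [d]-th roots keeps it inside a fixed ball.
    Iterating, the velocities [tau / mu ^ n * w i] obey Cauchy's estimate for all
    [n], hence [|mu| >= 1] ([tangent_expanding]). Points [u i] may coincide and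
    the orbit may pass through the critical point; so the motion is indexed by the
    pairs [(u i, w i)], and different pairs stay at a distance
    at least proportional to the parameter. All this needs [w i = 0] when [u i = 0],
    a consequence of the closing relations ([tangent_orbit_crit]). The function
    theory is done with uniform limits of polynomials on the closed disc; it
    consists of the existence of roots of nowhere vanishing functions
    ([disc_algebra_root]) and of Cauchy's estimate at the centre
    ([disc_algebra_jet_le]), which for polynomials is an averaging over roots of
    unity ([poly_coef1_le]).

    The second one is arithmetic. The [u i] are algebraic integers, and so is
    [mu]. If [|mu| = 1] then [1 / mu] is the conjugate of [mu], again an algebraic
    integer. Normalised by [w 1 = 1], all [w i] with [i > 0] are then congruent to
    1 modulo [d], and the closing relation forces [k > 0] and [beta] congruent to 1
    modulo [d]. As [beta] is a nontrivial [d]-th root of unity this leaves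
    only [d = 2], which a congruence modulo 4 excludes ([unimodular_absurd]). *)

Set Implicit Arguments.
Unset Strict Implicit.
Unset Printing Implicit Defensive.

(** * Real-valued modulus *)

Section Modulus.
Variable R : realType.
Implicit Types x y z : R[i].

(** The norm of [R[i]] takes its values in [R[i]]; its real part is the same
    number in [R], a totally ordered field to which linear arithmetic applies. *)
Definition absc z : R := complex.Re `|z|.

Lemma abscE z : `|z| = (absc z)%:C.
Proof. by rewrite /absc RRe_real ?normr_real. Qed.

Lemma absc_ge0 z : 0 <= absc z.
Proof. by rewrite -lecR -abscE rmorph0 normr_ge0. Qed.

Lemma absc0 : absc 0 = 0.
Proof. by rewrite /absc normr0. Qed.

Lemma absc1 : absc 1 = 1.
Proof. by rewrite /absc normr1. Qed.

Lemma abscM x y : absc (x * y) = absc x * absc y.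
Proof. by apply: complexI; rewrite rmorphM -!abscE normrM. Qed.

Lemma abscN x : absc (- x) = absc x.
Proof. by rewrite /absc normrN. Qed.

Lemma absc_distC x y : absc (x - y) = absc (y - x).
Proof. by rewrite -abscN opprB. Qed.

Lemma abscD x y : absc (x + y) <= absc x + absc y.
Proof. by rewrite -lecR rmorphD -!abscE ler_normD. Qed.

Lemma abscB x y : absc (x - y) <= absc x + absc y.
Proof. by rewrite -(abscN y) abscD. Qed.

Lemma abscB_ge x y : absc x - absc y <= absc (x - y).
Proof. by have := abscD (x - y) y; rewrite subrK; lra. Qed.

Lemma abscX x n : absc (x ^+ n) = absc x ^+ n.
Proof. by elim: n => [|n IH]; rewrite ?expr0 ?absc1 // !exprS abscM IH. Qed.

Lemma absc_eq0 x : (absc x == 0) = (x == 0).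
Proof. by rewrite -[RHS]normr_eq0 abscE; apply/eqP/eqP => [->|/complexI]. Qed.

Lemma absc_gt0 x : (0 < absc x) = (x != 0).
Proof. by rewrite lt_def absc_ge0 andbT absc_eq0. Qed.

Lemma abscV x : absc x^-1 = (absc x)^-1.
Proof.
have [->|x0] := eqVneq x 0; first by rewrite !(invr0, absc0).
have ax0 : absc x != 0 by rewrite absc_eq0.
by apply: (mulfI ax0); rewrite -abscM !divff // absc1.
Qed.

Lemma absc_nat n : absc n%:R = n%:R.
Proof. by rewrite /absc normr_nat -[n%:R](rmorph_nat (real_complex R)). Qed.

Lemma absc_real (t : R) : 0 <= t -> absc t%:C = t.
Proof. by move=> t0; rewrite /absc ger0_norm // lecR. Qed.

Lemma absc_sum (I : Type) (r : seq I) (P : pred I) (F : I -> R[i]) :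
  absc (\sum_(i <- r | P i) F i) <= \sum_(i <- r | P i) absc (F i).
Proof.
elim/big_ind2 : _ => [|x1 x2 y1 y2 h1 h2|//]; first by rewrite absc0.
by apply: le_trans (abscD _ _) _; apply: lerD.
Qed.

End Modulus.

Arguments absc {R} z : simpl never.

(** * Polynomials on the closed unit disc *)

Section PolynomialsOnDisc.
Variable R : realType.
Local Notation C := R[i].
Implicit Types (p q : {poly C}) (z : C).

Lemma poly_disc_bounded p :
  exists2 B, 0 <= B & forall z, absc z <= 1 -> absc p.[z] <= B.
Proof.
elim/poly_ind: p => [|p c [B B0 pB]].
  by exists 0 => // z _; rewrite horner0 absc0.
exists (B + absc c) => [|z z1]; first by rewrite addr_ge0 ?absc_ge0.
rewrite hornerMXaddC; apply: le_trans (abscD _ _) _; rewrite lerD2r abscM.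
by have := pB z z1; have := absc_ge0 p.[z]; have := absc_ge0 z; nra.
Qed.

Lemma poly_disc_lipschitz p :
  exists2 L, 0 < L & forall z z', absc z <= 1 -> absc z' <= 1 ->
    absc (p.[z] - p.[z']) <= L * absc (z - z').
Proof.
elim/poly_ind: p => [|p c [L L0 pL]].
  by exists 1 => // z z' _ _; rewrite !horner0 subrr absc0 mul1r absc_ge0.
have [B B0 pB] := poly_disc_bounded p.
exists (L + B) => [|z z' z1 z'1]; first by rewrite ltr_wpDr.
rewrite !hornerMXaddC.
have -> : p.[z] * z + c - (p.[z'] * z' + c) =
  (p.[z] - p.[z']) * z + p.[z'] * (z - z') by ring.
apply: le_trans (abscD _ _) _; rewrite !abscM.
have := pL z z' z1 z'1; have := pB z' z'1.
have := absc_ge0 z; have := absc_ge0 (z - z').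
have := absc_ge0 (p.[z] - p.[z']); have := absc_ge0 p.[z'].
nra.
Qed.

(** Averaging [p(X)] and [p(zeta X) / zeta], where [zeta ^ (2 ^ k) = -1], keeps
    the coefficient of [X], does not increase the sup norm, and halves the set
    of the other exponents that survive: after [k] steps only exponents
    congruent to 1 modulo [2 ^ k] are left. *)
Lemma poly_thin_out p (B : R) k :
  (forall z, absc z <= 1 -> absc p.[z] <= B) ->
  exists q : {poly C}, [/\ q`_1 = p`_1, (size q <= size p)%N,
    (forall z, absc z <= 1 -> absc q.[z] <= B) &
    forall j, q`_j != 0 -> (j = 1 %[mod 2 ^ k])%N].
Proof.
move=> pB; elim: k => [|k [q [q1 sq qB qj]]].
  by exists p; split => // j _; rewrite expn0 !modn1.
pose zeta : C := (2 ^ k)%N.-root (-1).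
have zetaE : zeta ^+ (2 ^ k) = -1 by rewrite rootCK // expn_gt0.
have azeta : absc zeta = 1.
  have : absc zeta ^+ (2 ^ k) == 1 by rewrite -abscX zetaE abscN absc1.
  by rewrite pexpr_eq1 ?expn_gt0 ?absc_ge0 // => /eqP.
have zeta0 : zeta != 0 by rewrite -absc_eq0 azeta oner_eq0.
pose q' := \poly_(j < size q) (2^-1 * (1 + zeta^-1 * zeta ^+ j) * q`_j).
have q'E j : q'`_j = 2^-1 * (1 + zeta^-1 * zeta ^+ j) * q`_j.
  by rewrite coef_poly; case: ltnP => // ?; rewrite nth_default ?mulr0.
have hq' z : q'.[z] = 2^-1 * (q.[z] + zeta^-1 * q.[zeta * z]).
  rewrite horner_poly !horner_coef mulr_sumr -big_split mulr_sumr /=.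
  by apply: eq_bigr => j _; rewrite exprMn; ring.
exists q'; split.
- by rewrite q'E expr1 mulVf // q1 -[1 + 1]/(2%:R) mulVf ?mul1r ?pnatr_eq0.
- by apply: leq_trans sq; apply: size_poly.
- move=> z z1; rewrite hq' abscM abscV absc_nat.
  have z2 : absc (zeta * z) <= 1 by rewrite abscM azeta mul1r.
  have := abscD q.[z] (zeta^-1 * q.[zeta * z]).
  rewrite abscM abscV azeta invr1 mul1r.
  by have := qB _ z1; have := qB _ z2; lra.
- move=> j; rewrite q'E; apply: contraNeq => jk.
  have [->|qj0] := eqVneq q`_j 0; first by rewrite mulr0.
  have jk1 := qj j qj0.
  suff -> : zeta ^+ j = - zeta by rewrite mulrN mulVf // subrr mulr0 mul0r.
  have [j0|j0] := posnP j.
    subst j; have k0 : k = 0%N.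
      case: k jk1 {jk qj zeta zetaE azeta zeta0 q' q'E hq'} => // k.
      by rewrite mod0n modn_small // -{1}(expn0 2) ltn_exp2l.
    by move: zetaE; rewrite k0 expn0 expr1 expr0 => ->; rewrite opprK.
  have /dvdnP [t jt] : (2 ^ k %| j - 1)%N by rewrite -eqn_mod_dvd ?jk1.
  have jE : j = (1 + t * 2 ^ k)%N by rewrite -jt subnKC.
  have todd : odd t.
    apply: contraNT jk => /even_halfK tE; rewrite jE -tE -muln2 -mulnA -expnS.
    by rewrite addnC modnMDl.
  by rewrite jE exprD expr1 mulnC exprM zetaE -signr_odd todd expr1 mulrN1.
Qed.

(** Once the exponents other than 1 are averaged away, the coefficient of [X] is
    the value at 1. *)
Lemma poly_coef1_le p (B : R) :
  (forall z, absc z <= 1 -> absc p.[z] <= B) -> absc p`_1 <= B.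
Proof.
move=> pB; have [q [<- sq qB qj]] := poly_thin_out (size p).+1 pB.
suff -> : q`_1 = q.[1] by apply: qB; rewrite absc1.
have lt2 : (size p < 2 ^ (size p).+1)%N.
  by apply: ltn_trans (ltnSn _) (ltn_expl _ _).
have qE j : (j < size q)%N -> j != 1%N -> q`_j = 0.
  move=> jq; apply: contraNeq => /qj.
  by rewrite !modn_small => [->|//|]; lia.
rewrite horner_coef; have [s1|s1] := ltnP 1 (size q); last first.
  rewrite nth_default // big1 // => -[j /= jq] _.
  by rewrite qE ?mul0r // neq_ltn (leq_trans jq s1).
rewrite (bigD1 (Ordinal s1)) //= expr1n mulr1 big1 ?addr0 // => -[j /= jq].
by rewrite -val_eqE /= => j1; rewrite qE ?mul0r.
Qed.

End PolynomialsOnDisc.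

(** * The disc algebra *)

Section DiscAlgebra.
Variable R : realType.
Local Notation C := R[i].
Implicit Types (F G H : C -> C) (z : C).

(** Uniform limits of polynomials play the part of holomorphic functions: they are
    stable under the algebraic operations and under roots, and they inherit
    Cauchy's estimate from polynomials. *)
Definition disc_algebra F := forall e : R, 0 < e ->
  exists p : {poly C}, forall z, absc z <= 1 -> absc (F z - p.[z]) <= e.

Lemma disc_algebra_poly (p : {poly C}) : disc_algebra (fun z => p.[z]).
Proof. by move=> e e0; exists p => z _; rewrite subrr absc0 ltW. Qed.

Lemma disc_algebra_cst (c : C) : disc_algebra (fun=> c).
Proof. by move=> e e0; exists c%:P => z _; rewrite hornerC subrr absc0 ltW. Qed.

Lemma disc_algebra_closed F :
  (forall e : R, 0 < e -> exists2 G, disc_algebra G &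
    forall z, absc z <= 1 -> absc (F z - G z) <= e) -> disc_algebra F.
Proof.
move=> FG e e0; have e20 : 0 < e / 2 by lra.
have [G /(_ _ e20) [p Gp] {}FG] := FG _ e20.
exists p => z z1; have -> : F z - p.[z] = (F z - G z) + (G z - p.[z]) by ring.
by apply: le_trans (abscD _ _) _; have := FG z z1; have := Gp z z1; lra.
Qed.

Lemma eq_disc_algebra F G :
  (forall z, absc z <= 1 -> F z = G z) -> disc_algebra G -> disc_algebra F.
Proof.
move=> FG hG; apply: disc_algebra_closed => e e0; exists G => // z z1.
by rewrite FG // subrr absc0 ltW.
Qed.

Lemma disc_algebra_bounded F : disc_algebra F ->
  exists2 B, 0 <= B & forall z, absc z <= 1 -> absc (F z) <= B.
Proof.
move=> /(_ 1 ltr01) [p Fp]; have [B B0 pB] := poly_disc_bounded p.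
exists (B + 1) => [|z z1]; first by lra.
have -> : F z = (F z - p.[z]) + p.[z] by ring.
by apply: le_trans (abscD _ _) _; have := Fp z z1; have := pB z z1; lra.
Qed.

Lemma disc_algebraD F G : disc_algebra F -> disc_algebra G ->
  disc_algebra (fun z => F z + G z).
Proof.
move=> hF hG e e0; have e20 : 0 < e / 2 by lra.
have [[p Fp] [q Gq]] := (hF _ e20, hG _ e20).
exists (p + q) => z z1; rewrite hornerD.
have -> : F z + G z - (p.[z] + q.[z]) = (F z - p.[z]) + (G z - q.[z]) by ring.
by apply: le_trans (abscD _ _) _; have := Fp z z1; have := Gq z z1; lra.
Qed.

Lemma disc_algebraM F G : disc_algebra F -> disc_algebra G ->
  disc_algebra (fun z => F z * G z).
Proof.
move=> hF hG e e0.
have [BF BF0 FB] := disc_algebra_bounded hF.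
have [BG BG0 GB] := disc_algebra_bounded hG.
pose B := BF + BG + 1; have B0 : 0 < B by rewrite /B; lra.
pose t := Num.min 1 (e / B).
have t0 : 0 < t by rewrite lt_min ltr01 divr_gt0.
have t1 : t <= 1 by rewrite ge_min lexx.
have tB : t * B <= e by rewrite -ler_pdivlMr // ge_min lexx orbT.
have [[p Fp] [q Gq]] := (hF _ t0, hG _ t0).
exists (p * q) => z z1; rewrite hornerM.
have -> : F z * G z - p.[z] * q.[z] =
  F z * (G z - q.[z]) + (G z - (G z - q.[z])) * (F z - p.[z]) by ring.
apply: le_trans (abscD _ _) _; rewrite !abscM.
have := abscB (G z) (G z - q.[z]).
move: (FB z z1) (GB z z1) (Fp z z1) (Gq z z1).
move: (absc_ge0 (F z)) (absc_ge0 (G z)) (absc_ge0 (F z - p.[z])).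
move: (absc_ge0 (G z - q.[z])) (absc_ge0 (G z - (G z - q.[z]))).
move: (absc (F z)) (absc (G z)) (absc (F z - p.[z])) => f g fp.
move: (absc (G z - q.[z])) (absc (G z - (G z - q.[z]))) => gq g'.
move=> gq0 g'0 fp0 g0 f0 fB gB fpt gqt g'le.
apply: le_trans tB; rewrite /B.
have h1 : f * gq <= BF * t by apply: ler_pM.
have h2 : g' * fp <= (BG + 1) * t by apply: ler_pM => //; lra.
by lra.
Qed.

Lemma disc_algebraZ (c : C) F : disc_algebra F -> disc_algebra (fun z => c * F z).
Proof. exact/disc_algebraM/disc_algebra_cst. Qed.

Lemma disc_algebraB F G : disc_algebra F -> disc_algebra G ->
  disc_algebra (fun z => F z - G z).
Proof.
move=> hF hG; apply: (@eq_disc_algebra _ (fun z => F z + -1 * G z)).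
  by move=> z _; rewrite mulN1r.
by apply: disc_algebraD => //; apply: disc_algebraZ.
Qed.

Lemma disc_algebraX F n : disc_algebra F -> disc_algebra (fun z => F z ^+ n).
Proof.
move=> hF; elim: n => [|n IH].
  by apply: (eq_disc_algebra _ (disc_algebra_cst 1)) => z _; rewrite expr0.
by apply: (eq_disc_algebra _ (disc_algebraM hF IH)) => z _; rewrite exprS.
Qed.

Lemma disc_algebra_scale (s : C) F : absc s <= 1 -> disc_algebra F ->
  disc_algebra (fun z => F (s * z)).
Proof.
move=> s1 hF e e0; have [p Fp] := hF e e0; exists (p \Po (s *: 'X)) => z z1.
rewrite horner_comp hornerZ hornerX; apply: Fp; rewrite abscM.
by rewrite mulr_ile1 ?absc_ge0.
Qed.

Lemma disc_algebra_ucont F : disc_algebra F -> forall e : R, 0 < e ->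
  exists2 h : R, 0 < h & forall z z', absc z <= 1 -> absc z' <= 1 ->
    absc (z - z') <= h -> absc (F z - F z') <= e.
Proof.
move=> hF e e0; have e30 : 0 < e / 3%:R by lra.
have [p Fp] := hF _ e30; have [L L0 pL] := poly_disc_lipschitz p.
exists (e / 3%:R / L) => [|z z' z1 z'1]; first by rewrite divr_gt0.
rewrite ler_pdivlMr // mulrC => zz'.
have -> : F z - F z' = (F z - p.[z]) + (p.[z] - p.[z']) - (F z' - p.[z']) by ring.
apply: le_trans (abscB _ _) _; apply: le_trans (lerD (abscD _ _) (lexx _)) _.
by move: (Fp z z1) (Fp z' z'1) (pL z z' z1 z'1) zz'; lra.
Qed.

(** A linear lower bound says nothing at the origin itself; continuity there
    turns it into a uniform one. *)
Lemma disc_algebra_away0 F (a : R) : disc_algebra F -> F 0 != 0 -> 0 < a ->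
  (forall z, absc z <= 1 -> a * absc z <= absc (F z)) ->
  exists2 b : R, 0 < b & forall z, absc z <= 1 -> b <= absc (F z).
Proof.
move=> hF F0 a0 Fa; have F00 : 0 < absc (F 0) by rewrite absc_gt0.
have e0 : 0 < absc (F 0) / 2 by lra.
have [h h0 Fh] := disc_algebra_ucont hF e0.
exists (Num.min (absc (F 0) / 2) (a * h)) => [|z z1].
  by rewrite lt_min e0 mulr_gt0.
rewrite ge_min; have [zh|hz] := lerP (absc z) h; apply/orP; [left|right].
  have := Fh z 0 z1; rewrite absc0 subr0 ler01 => /(_ isT zh).
  by have := abscB_ge (F 0) (F z); rewrite absc_distC; lra.
by apply: le_trans (Fa z z1); rewrite ler_pM2l // ltW.
Qed.

End DiscAlgebra.

(** * Roots in the disc algebra *)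

Section Roots.
Variable R : realType.
Local Notation C := R[i].
Implicit Types (F G H : C -> C) (z : C).

Lemma exists_small_pow (x e : R) : 0 <= x -> x < 1 -> 0 < e ->
  exists n, x ^+ n <= e.
Proof.
move=> x0 x1 e0; have [->|xneq0] := eqVneq x 0.
  by exists 1%N; rewrite expr1 ltW.
have xgt0 : 0 < x by rewrite lt_def xneq0.
pose h := x^-1 - 1; have h0 : 0 < h by rewrite subr_gt0 invf_gt1.
have bern n : 1 + n%:R * h <= x^-1 ^+ n.
  elim: n => [|n IH]; first by rewrite expr0 mul0r addr0.
  rewrite exprS -natr1; apply: le_trans (ler_wpM2l _ IH); last by rewrite invr_ge0.
  have -> : x^-1 = 1 + h by rewrite /h; ring.
  have : 0 <= n%:R * h * h by rewrite -mulrA mulr_ge0 // mulr_ge0 // ltW.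
  by lra.
pose n := Num.bound (e^-1 / h).
have : e^-1 / h < n%:R by rewrite archi_boundP // divr_ge0 ?invr_ge0 ?ltW.
rewrite ltr_pdivrMr // => en; exists n.
rewrite -[leRHS]invrK -[leLHS]invrK lef_pV2 ?posrE ?invr_gt0 ?exprn_gt0 //.
by rewrite -exprVn; apply: le_trans (bern n); lra.
Qed.

(** The distances from 1 to the [d] roots of [a] multiply to [absc (a - 1)], so
    one of them is small when [a] is close to 1. *)
Lemma exists_root_near1 d (a : C) (e : R) : (0 < d)%N -> 0 < e ->
  absc (a - 1) <= e ^+ d -> exists2 y, y ^+ d = a & absc (y - 1) <= e.
Proof.
move=> d0 e0 ae; have [r rE] := closed_field_poly_normal ('X^d - a%:P : {poly C}).
have : lead_coef ('X^d - a%:P) = 1 :> C by rewrite lead_coefXnsubC.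
move=> lE; rewrite {}lE scale1r in rE.
have sr : size r = d.
  by apply: succn_inj; rewrite -(size_prod_XsubC r id) -rE size_XnsubC.
have rootr y : y \in r -> y ^+ d = a.
  rewrite -root_prod_XsubC -rE rootE hornerD hornerN hornerXn hornerC subr_eq0.
  by move/eqP.
have [|/hasPn far] := boolP (has (fun y => absc (y - 1) <= e) r).
  by move=> /hasP [y yr ye]; exists y; rewrite ?rootr.
have rE1 : 1 - a = \prod_(y <- r) (1 - y).
  move/(congr1 (fun p : {poly C} => p.[1])): rE; rewrite hornerD hornerN hornerXn.
  rewrite hornerC expr1n => ->; rewrite horner_prod; apply: eq_bigr => y _.
  by rewrite hornerXsubC.
suff : e ^+ d < absc (1 - a) by rewrite absc_distC ltNge ae.
rewrite {}rE1 -sr; move: d0; rewrite -sr; move: far; clear -e0.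
elim: r => // y r IH far _; rewrite big_cons abscM exprS.
have ye : e < absc (1 - y) by rewrite absc_distC ltNge far ?mem_head.
case: r IH far => [_ _|y' r IH far].
  by rewrite big_nil absc1 expr0 !mulr1.
apply: ltr_pM => //; [exact: ltW|exact/exprn_ge0/ltW|apply: IH => //].
by move=> w wr; apply: far; rewrite inE wr orbT.
Qed.

Lemma absc_expr_near1 (r : R) (y : C) n : 0 <= r -> absc (y - 1) <= r ->
  absc (y ^+ n - 1) <= (1 + r) ^+ n - 1.
Proof.
move=> r0 yr; elim: n => [|n IH]; first by rewrite !expr0 !subrr absc0.
rewrite !exprS; have -> : y * y ^+ n - 1 = (y - 1) * (y ^+ n - 1) +
  (y - 1) + (y ^+ n - 1) by ring.
apply: le_trans (abscD _ _) _; apply: le_trans (lerD (abscD _ _) (lexx _)) _.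
rewrite abscM; move: IH yr (absc_ge0 (y - 1)) (absc_ge0 (y ^+ n - 1)).
by move: (absc (y ^+ n - 1)) (absc (y - 1)) (_ ^+ n) => s t u; nra.
Qed.

Lemma exists_radius n : exists2 r : R, 0 < r & (1 + r) ^+ n <= 5%:R / 4%:R.
Proof.
exists (1 / 4%:R / 3%:R ^+ n); first by rewrite divr_gt0 ?exprn_gt0 //; lra.
have n3 : 1 <= 3%:R ^+ n :> R by rewrite exprn_ege1 // ler1n.
set r := _ / _; have r0 : 0 <= r by rewrite divr_ge0 ?exprn_ge0 //; lra.
have r1 : r <= 1.
  by rewrite /r ler_pdivrMr; [lra|rewrite exprn_gt0].
suff h m : (1 + r) ^+ m <= 1 + 3%:R ^+ m * r.
  apply: le_trans (h n) _; rewrite /r mulrCA divff ?expf_neq0 ?pnatr_eq0 //.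
  by lra.
elim: m => [|m IH]; first by rewrite !expr0; lra.
have m3 : 1 <= 3%:R ^+ m :> R by rewrite exprn_ege1 // ler1n.
rewrite !exprS; apply: le_trans (ler_wpM2l _ IH) _; first by lra.
have h1 : 0 <= (3%:R ^+ m - 1) * r by rewrite mulr_ge0 ?subr_ge0.
have h2 : 0 <= 3%:R ^+ m * r * (1 - r).
  by apply: mulr_ge0; rewrite ?subr_ge0 // mulr_ge0 // exprn_ge0.
by move: h1 h2; move: (3%:R ^+ m) => t; nra.
Qed.

(** Newton's iteration with frozen slope, [y - (y ^ d * F - 1) / d], is polynomial
    in [F] and contracts towards the root near 1, uniformly on the disc. The
    constants give the contraction factor [(6 / 5) * (5 / 4) - 1 = 1 / 2]. *)
Lemma disc_algebra_invroot_near1 d : (0 < d)%N -> exists2 r : R, 0 < r &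
  forall F, disc_algebra F -> (forall z, absc z <= 1 -> absc (F z - 1) <= r) ->
  exists2 Y, disc_algebra Y & forall z, absc z <= 1 -> Y z ^+ d * F z = 1.
Proof.
move=> d0; have [r r0 rd] := exists_radius d.-1.
have dR : d%:R != 0 :> C by rewrite pnatr_eq0 -lt0n.
have dR0 : 0 < d%:R :> R by rewrite ltr0n.
pose r' := Num.min r 2 / 2.
have r'0 : 0 < r' by rewrite divr_gt0 // lt_min r0 ltr0n.
have r'r : 2 * r' <= r by rewrite /r' mulrC divfK ?pnatr_eq0 // ge_min lexx.
have r'1 : r' <= 1.
  by rewrite /r' ler_pdivrMr ?ltr0n // mul1r ge_min lexx orbT.
exists (Num.min (1 / 5%:R) (r' ^+ d / 2)) => [|F hF F1].
  by rewrite lt_min !divr_gt0 ?exprn_gt0 ?ltr0n.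
have F15 z : absc z <= 1 -> absc (F z - 1) <= 1 / 5%:R.
  by move=> /F1; rewrite le_min => /andP[].
have F12 z : absc z <= 1 -> 1 / 2 <= absc (F z).
  by move=> /F15; rewrite absc_distC; have := abscB_ge 1 (F z); rewrite absc1; lra.
have F0 z : absc z <= 1 -> F z != 0 by move=> /F12 h; rewrite -absc_gt0; lra.
have [|Y Yroot] := @choice C C (fun z y => absc z <= 1 ->
    y ^+ d = (F z)^-1 /\ absc (y - 1) <= r').
  move=> z.
  have [z1|/negP z1] := boolP (absc z <= 1); last by exists 0.
  have [|y yd yr] := @exists_root_near1 d (F z)^-1 r' d0 r'0; last by exists y.
  have -> : (F z)^-1 - 1 = (F z)^-1 * (1 - F z).
    by rewrite mulrBr mulr1 mulVf ?F0.
  rewrite abscM abscV absc_distC ler_pdivrMl; last by rewrite absc_gt0 F0.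
  have := F1 z z1; rewrite le_min => /andP[_ h]; have := F12 z z1.
  by move: h (exprn_gt0 d r'0); move: (r' ^+ d) (absc (F z)) (absc _) => s t u; nra.
have YF z : absc z <= 1 -> Y z ^+ d * F z = 1.
  by move=> z1; have [-> _] := Yroot z z1; rewrite mulVf ?F0.
exists Y => //.
pose T n z := iter n (fun y => y - d%:R^-1 * (y ^+ d * F z - 1)) 1.
have T_disc n : disc_algebra (T n).
  elim: n => [|n IH]; first exact: disc_algebra_cst.
  apply: disc_algebraB => //; apply: disc_algebraZ.
  by apply: disc_algebraB (disc_algebra_cst _); apply/disc_algebraM/hF/disc_algebraX.
have TY n z : absc z <= 1 -> absc (T n z - Y z) <= r' * (2^-1) ^+ n.
  move=> z1; have [Yd Y1] := Yroot z z1.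
  elim: n => [|n IH]; first by rewrite expr0 mulr1 absc_distC.
  have Tr : absc (T n z - 1) <= r.
    have -> : T n z - 1 = (T n z - Y z) + (Y z - 1) by ring.
    apply: le_trans (abscD _ _) _.
    have : (2^-1) ^+ n <= 1 :> R by rewrite exprn_ile1 //; lra.
    by move: IH Y1 r'r r'0; move: (_ ^+ n) => t; nra.
  rewrite /T iterS -/(T n z); set y := T n z in IH Tr *.
  (* [y ^ d - Y ^ d = (y - Y) Q], and [Q] is close to [d] since [y] and [Y] are
     close to 1 *)
  pose Q := \sum_(i < d) y ^+ (d.-1 - i) * Y z ^+ i.
  have -> : y - d%:R^-1 * (y ^+ d * F z - 1) - Y z =
      (y - Y z) * (1 - d%:R^-1 * (Q * F z)).
    have -> : y ^+ d * F z - 1 = (y - Y z) * Q * F z.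
      by rewrite -[X in _ - X](YF z z1) -mulrBl subrXX.
    by ring.
  rewrite abscM exprSr [leRHS]mulrA; apply: ler_pM; rewrite ?absc_ge0 //.
  have Qd : absc (Q - d%:R) <= d%:R / 4%:R.
    have -> : Q - d%:R = \sum_(i < d) (y ^+ (d.-1 - i) * Y z ^+ i - 1).
      by rewrite sumrB sumr_const card_ord.
    apply: le_trans (absc_sum _ _ _) _.
    have -> : d%:R / 4%:R = \sum_(i < d) (1 / 4%:R) :> R.
      by rewrite sumr_const card_ord -[RHS]mulr_natl mul1r.
    apply: ler_sum => i _.
    have Yr : absc (Y z - 1) <= r by apply: le_trans Y1 _; lra.
    have := absc_expr_near1 (d.-1 - i) (ltW r0) Tr.
    have := absc_expr_near1 i (ltW r0) Yr.
    set u := y ^+ _; set v := Y z ^+ _ => hv hu.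
    have -> : u * v - 1 = (u - 1) * (v - 1) + (u - 1) + (v - 1) by ring.
    apply: le_trans (abscD _ _) _; apply: le_trans (lerD (abscD _ _) (lexx _)) _.
    have idd : (1 + r) ^+ (d.-1 - i) * (1 + r) ^+ i <= 5%:R / 4%:R.
      by rewrite -exprD subnK // -ltnS prednK.
    rewrite abscM; move: hu hv idd (absc_ge0 (u - 1)) (absc_ge0 (v - 1)).
    by move: (absc _) (absc (v - 1)) ((1 + r) ^+ _) (_ ^+ i) => a b a' b'; nra.
  have -> : 1 - d%:R^-1 * (Q * F z) =
      - d%:R^-1 * ((Q - d%:R) * F z + d%:R * (F z - 1)).
    by field.
  rewrite abscM abscN abscV absc_nat ler_pdivrMl //.
  apply: le_trans (abscD _ _) _; rewrite !abscM absc_nat.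
  have Fz : absc (F z) <= 6%:R / 5%:R.
    by have := abscD (F z - 1) 1; rewrite subrK absc1; have := F15 z z1; lra.
  have h1 : absc (Q - d%:R) * absc (F z) <= d%:R / 4%:R * (6%:R / 5%:R).
    by apply: ler_pM; rewrite ?absc_ge0.
  have h2 : d%:R * absc (F z - 1) <= d%:R * (1 / 5%:R).
    by rewrite ler_pM2l // F15.
  by lra.
apply: disc_algebra_closed => e e0; have half1 : (2^-1 : R) < 1 by lra.
have [|n ne] := exists_small_pow _ half1 e0; first by rewrite invr_ge0.
exists (T n) => // z z1; rewrite absc_distC; apply: le_trans (TY n z z1) _.
by apply: le_trans ne; rewrite ler_piMl // exprn_ge0 // invr_ge0.
Qed.

(** Since the disc is contractible, a nowhere vanishing function on it has a
    root: [F] is joined to the constant 1 through the functions [F (s z)],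
    [0 <= s <= 1]; by uniform continuity the quotient of two nearby ones is
    close to 1 and has a root. The induction carries the inverse of the root, so
    that no division is needed. *)
Lemma disc_algebra_root d F (b : R) : (0 < d)%N -> disc_algebra F -> F 0 = 1 ->
  0 < b -> (forall z, absc z <= 1 -> b <= absc (F z)) ->
  exists W, [/\ disc_algebra W, W 0 = 1 & forall z, absc z <= 1 -> W z ^+ d = F z].
Proof.
move=> d0 hF F01 b0 Fb; have [r r0 near1] := @disc_algebra_invroot_near1 d d0.
have Fneq0 z : absc z <= 1 -> F z != 0.
  by move=> /Fb h; rewrite -absc_gt0; apply: lt_le_trans h.
have [h h0 Fh] := disc_algebra_ucont hF (mulr_gt0 r0 b0).
pose M := (Num.bound h^-1).+1.
have M0 : 0 < M%:R :> R by rewrite ltr0n.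
have Mh : M%:R^-1 <= h.
  have hM : h^-1 < M%:R.
    have /archi_boundP hb : 0 <= h^-1 by rewrite invr_ge0 ltW.
    by apply: (lt_le_trans hb); rewrite ler_nat leqnSn.
  by rewrite -[leRHS]invrK lef_pV2 ?posrE ?invr_gt0 // ltW.
pose s j : C := j%:R / M%:R.
have s1 j : (j <= M)%N -> absc (s j) <= 1.
  by move=> jM; rewrite abscM abscV !absc_nat ler_pdivrMr // mul1r ler_nat.
have sz1 j z : (j <= M)%N -> absc z <= 1 -> absc (s j * z) <= 1.
  by move=> jM z1; rewrite abscM mulr_ile1 ?absc_ge0 ?s1.
have step j : (j <= M)%N -> exists2 K, disc_algebra K &
    forall z, absc z <= 1 -> K z ^+ d * F (s j * z) = 1.
  elim: j => [_|j IH jM].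
    exists (fun=> 1) => [|z _]; first exact: disc_algebra_cst.
    by rewrite expr1n mul1r /s mul0r mul0r.
  have [K hK KF] := IH (ltnW jM).
  have [||Y hY YF] := near1 (fun z => K z ^+ d * F (s j.+1 * z)).
  - apply: disc_algebraM; first exact: disc_algebraX.
    by apply: disc_algebra_scale => //; apply: s1.
  - move=> z z1; rewrite -(KF z z1) -mulrBr abscM.
    have Fj0 := Fneq0 _ (sz1 _ _ (ltnW jM) z1).
    have -> : K z ^+ d = (F (s j * z))^-1 by rewrite -[RHS]mul1r -(KF z z1) mulfK.
    rewrite abscV ler_pdivrMl ?absc_gt0 //.
    apply: (@le_trans _ _ (r * b)); last by rewrite mulrC ler_pM2r // Fb ?sz1 // ltnW.
    apply: Fh; rewrite ?sz1 //; first exact: ltnW.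
    rewrite -mulrBl abscM /s -mulrBl -natrB ?leqnSn // subSnn mul1r abscV absc_nat.
    by apply: le_trans Mh; rewrite ler_piMr // invr_ge0 ltW.
  exists (fun z => Y z * K z) => [|z z1]; first exact: disc_algebraM.
  by rewrite exprMn -mulrA YF.
have [K hK KF] := step M (leqnn M).
have sM : s M = 1 by rewrite /s divff // pnatr_eq0.
have {}KF z : absc z <= 1 -> K z ^+ d * F z = 1.
  by move=> z1; have := KF z z1; rewrite sM mul1r.
pose W z := K z ^+ d.-1 * F z.
have WF z : absc z <= 1 -> W z ^+ d = F z.
  move=> z1; rewrite /W exprMn exprAC -[in F z ^+ d](prednK d0) exprS mulrCA.
  by rewrite -exprMn KF // expr1n mulr1.
have W0d : W 0 ^+ d = 1 by rewrite WF // absc0.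
have W0 : W 0 != 0.
  by apply: contra_eqN W0d => /eqP ->; rewrite expr0n (gtn_eqF d0) eq_sym oner_eq0.
exists (fun z => (W 0)^-1 * W z); split.
- by apply/disc_algebraZ/disc_algebraM => //; apply: disc_algebraX.
- by rewrite mulVf.
- by move=> z z1; rewrite exprMn WF // exprVn W0d invr1 mul1r.
Qed.

End Roots.

(** * First-order jets *)

Section Jets.
Variable R : realType.
Local Notation C := R[i].
Implicit Types (F G : C -> C) (z : C).

(** The derivative at the centre of the disc is what Cauchy's estimate bounds. *)
Definition jet F (a b : C) := forall e : R, 0 < e ->
  exists2 h : R, 0 < h & forall z, absc z <= h ->
    absc (F z - a - b * z) <= e * absc z.

Lemma jet_at0 F a b : jet F a b -> F 0 = a.
Proof.
move=> /(_ 1 ltr01) [h h0 /(_ 0)]; rewrite absc0 => /(_ (ltW h0)).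
rewrite mulr0 subr0 mulr0 => Fa; apply/eqP; rewrite -subr_eq0 -absc_eq0.
by rewrite eq_le Fa absc_ge0.
Qed.

Lemma eq_jet F G a b : (forall z, absc z <= 1 -> F z = G z) ->
  jet G a b -> jet F a b.
Proof.
move=> FG jG e e0; have [h h0 Gh] := jG e e0.
exists (Num.min 1 h) => [|z]; first by rewrite lt_min ltr01.
by rewrite le_min => /andP[z1 zh]; rewrite FG // Gh.
Qed.

Lemma jet_affine (a b : C) : jet (fun z => a + b * z) a b.
Proof.
move=> e e0; exists 1 => // z _; have -> : a + b * z - a - b * z = 0 by ring.
rewrite absc0.
by rewrite mulr_ge0 ?absc_ge0 // ltW.
Qed.

Lemma jetB F G a b a' b' : jet F a b -> jet G a' b' ->
  jet (fun z => F z - G z) (a - a') (b - b').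
Proof.
move=> jF jG e e0; have e20 : 0 < e / 2 by lra.
have [[h h0 Fh] [k k0 Gk]] := (jF _ e20, jG _ e20).
exists (Num.min h k) => [|z]; first by rewrite lt_min h0.
rewrite le_min => /andP[/Fh Fz /Gk Gz].
have -> : F z - G z - (a - a') - (b - b') * z =
  (F z - a - b * z) - (G z - a' - b' * z) by ring.
by apply: le_trans (abscB _ _) _; lra.
Qed.

(** Cauchy's estimate. The first coefficient of a polynomial approximation of
    [F] is close to [b], by the estimate for polynomials on a small disc, and
    bounded by [B], by the same estimate on the unit disc. *)
Lemma disc_algebra_jet_le F a b (B : R) : disc_algebra F -> jet F a b ->
  (forall z, absc z <= 1 -> absc (F z) <= B) -> absc b <= B.
Proof.
move=> hF jF FB; apply/ler_addgt0Pl => e e0.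
have e30 : 0 < e / 3%:R by lra.
have [h' h'0 Fh'] := jF _ e30; pose h := Num.min 1 h'.
have h0 : 0 < h by rewrite lt_min ltr01.
have h1 : h <= 1 by rewrite ge_min lexx.
have hh' : h <= h' by rewrite ge_min lexx orbT.
have [p Fp] := hF (e / 3%:R * h) (mulr_gt0 e30 h0).
have pB : absc p`_1 <= B + e / 3%:R * h.
  apply: poly_coef1_le => z z1.
  have -> : p.[z] = F z - (F z - p.[z]) by ring.
  by apply: le_trans (abscB _ _) _; have := FB z z1; have := Fp z z1; lra.
pose q := p \Po (h%:C *: 'X) - a%:P - (b * h%:C) *: 'X.
have qE z : q.[z] = p.[h%:C * z] - a - b * (h%:C * z).
  by rewrite !hornerD !hornerN horner_comp !hornerZ hornerC !hornerX mulrA.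
have ah : absc h%:C = h by rewrite absc_real // ltW.
have q1 : q`_1 = (p`_1 - b) * h%:C.
  rewrite !coefB coefC coefZ coefX eqxx mulr1 subr0 mulrBl; congr (_ - _).
  rewrite coef_comp_poly; have [sp|sp] := ltnP 1 (size p); last first.
    rewrite [in RHS]nth_default // mul0r big1 // => i _.
    rewrite exprZn coefZ coefXn.
    by have := leq_trans (ltn_ord i) sp; case: (nat_of_ord i) => // _; rewrite !mulr0.
  rewrite (bigD1 (Ordinal sp)) //= expr1 coefZ coefX eqxx mulr1 big1 ?addr0 //.
  move=> i; rewrite -val_eqE /= => i1; rewrite exprZn coefZ coefXn eq_sym.
  by rewrite (negPf i1) !mulr0.
have : absc q`_1 <= 2 * (e / 3%:R) * h.
  apply: poly_coef1_le => z z1; rewrite qE.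
  have hz : absc (h%:C * z) <= h.
    by rewrite abscM ah ler_piMr // ltW.
  have -> : p.[h%:C * z] - a - b * (h%:C * z) =
    (F (h%:C * z) - a - b * (h%:C * z)) - (F (h%:C * z) - p.[h%:C * z]) by ring.
  apply: le_trans (abscB _ _) _.
  have := Fh' _ (le_trans hz hh'); have := Fp _ (le_trans hz h1).
  have : e / 3%:R * absc (h%:C * z) <= e / 3%:R * h by rewrite ler_pM2l.
  by lra.
rewrite q1 abscM ah ler_pM2r // => pb.
have -> : b = p`_1 - (p`_1 - b) by ring.
apply: le_trans (abscB _ _) _.
have : e / 3%:R * h <= e / 3%:R by rewrite ler_piMr // ltW.
by lra.
Qed.

(** The jet of a root: [V ^ d - v ^ d] is [V - v] times a factor that tends to
    [d v ^ (d - 1)], which is not 0. *)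
Lemma jet_root V d (v t : C) : disc_algebra V -> (0 < d)%N -> v != 0 -> V 0 = v ->
  jet (fun z => V z ^+ d) (v ^+ d) (d%:R * v ^+ d.-1 * t) -> jet V v t.
Proof.
move=> hV d0 v0 V0 jVd e e0.
pose m := d%:R * v ^+ d.-1; pose Q z := \sum_(i < d) V z ^+ (d.-1 - i) * v ^+ i.
have QV z : V z ^+ d - v ^+ d = (V z - v) * Q z by rewrite subrXX.
have Q0 : Q 0 = m.
  rewrite /Q /m V0 mulr_natl -[X in _ *+ X]card_ord -sumr_const.
  by apply: eq_bigr => i _; rewrite -exprD subnK // -ltnS prednK.
have hQ : disc_algebra Q.
  rewrite /Q; elim: (index_enum _) => [|i s IH].
    by apply: (eq_disc_algebra _ (disc_algebra_cst 0)) => z _; rewrite big_nil.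
  apply: (@eq_disc_algebra _ _ (fun z => V z ^+ (d.-1 - i) * v ^+ i +
    \sum_(j <- s) V z ^+ (d.-1 - j) * v ^+ j)); first by move=> z _; rewrite big_cons.
  by apply: disc_algebraD => //; apply/disc_algebraM/disc_algebra_cst/disc_algebraX.
have m0 : 0 < absc m.
  by rewrite absc_gt0 mulf_neq0 ?expf_neq0 // pnatr_eq0 -lt0n.
pose k : R := Num.min (absc m / 2) (e * absc m / (4%:R * (absc t + 1))).
have t0 := absc_ge0 t.
have k0 : 0 < k.
  by rewrite lt_min !divr_gt0 ?mulr_gt0 //; lra.
have km : k <= absc m / 2 by rewrite ge_min lexx.
have kt : k * (4%:R * (absc t + 1)) <= e * absc m.
  by rewrite -ler_pdivlMr ?ge_min ?lexx ?orbT //; lra.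
have [h1 h10 Qh] := disc_algebra_ucont hQ k0.
have em0 : 0 < e * absc m / 4%:R by rewrite divr_gt0 ?mulr_gt0.
have [h2 h20 Vh] := jVd _ em0.
exists (Num.min 1 (Num.min h1 h2)) => [|z]; first by rewrite !lt_min ltr01 h10.
rewrite !le_min => /and3P[z1 zh1 zh2].
have := Vh z zh2; rewrite QV -/m.
have := Qh z 0 z1; rewrite absc0 subr0 ler01 Q0 => /(_ isT zh1) Qm.
set y := V z - v.
have -> : y * Q z - m * t * z = Q z * (y - t * z) + (Q z - m) * t * z by ring.
move=> h.
have Qz : absc m / 2 <= absc (Q z).
  by have := abscB_ge m (Q z); rewrite absc_distC; lra.
have h3 : absc (Q z * (y - t * z)) - absc ((Q z - m) * t * z) <=
    e * absc m / 4%:R * absc z.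
  apply: le_trans h; rewrite -(abscN ((Q z - m) * t * z)).
  by rewrite -[in leRHS](opprK ((Q z - m) * t * z)) abscB_ge.
rewrite abscM (abscM _ z) (abscM (Q z - m)) in h3.
have h4 : absc (Q z - m) * absc t * absc z <= e * absc m / 4%:R * absc z.
  apply: ler_wpM2r; first exact: absc_ge0.
  have : absc (Q z - m) * absc t <= k * (absc t + 1).
    by apply: ler_pM; rewrite ?absc_ge0 //; lra.
  by lra.
have h5 : absc m / 2 * absc (y - t * z) <= absc (Q z) * absc (y - t * z).
  by apply: ler_wpM2r => //; apply: absc_ge0.
have : absc m / 2 * absc (y - t * z) <= absc m / 2 * (e * absc z) by lra.
by rewrite ler_pM2l; last lra.
Qed.

End Jets.

(** * Backward invariance under the linearised critical orbit *)

Section HolomorphicMotion.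
Variable R : realType.
Local Notation C := R[i].
Implicit Types (p q : C * C) (z : C) (S : seq (C * C)).

Lemma exists_pos_lower_bound (T : eqType) (s : seq T) (f : T -> R) :
  (forall x, x \in s -> 0 < f x) ->
  exists2 t, 0 < t & forall x, x \in s -> t <= f x.
Proof.
elim: s => [|x s IH] fs; first by exists 1.
have [|t t0 ft] := IH; first by move=> y ys; apply: fs; rewrite inE ys orbT.
exists (Num.min t (f x)) => [|y]; first by rewrite lt_min t0 fs ?mem_head.
by rewrite inE ge_min => /predU1P[->|/ft ->//]; rewrite lexx orbT.
Qed.

Lemma exists_upper_bound (T : eqType) (s : seq T) (f : T -> R) :
  exists2 t, 2 <= t & forall x, x \in s -> f x <= t.
Proof.
elim: s => [|x s [t t2 ft]]; first by exists 2.
exists (Num.max t (f x)) => [|y]; first by rewrite le_max t2.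
by rewrite inE le_max => /predU1P[->|/ft ->//]; rewrite lexx orbT.
Qed.

Variables (d : nat) (c w1 mu : C).
Hypotheses (d2 : (1 < d)%N) (mu0 : mu != 0).

(** A pair is a point with a tangent vector; the step is [x ^ d + c] on points and
    on vectors the relation satisfied by an eigenvector, solved for the next one. *)
Definition tangent_step p : C * C := (p.1 ^+ d + c, w1 + d%:R * p.1 ^+ d.-1 * p.2 / mu).

(** Points indexed by different pairs may coincide at the centre of the disc, where
    they have different velocities; hence the linear lower bound. *)
Definition holomorphic_motion S (B : R) (tau : C) (U : C * C -> C -> C) := [/\
  forall p, p \in S -> disc_algebra (U p),
  forall p z, p \in S -> absc z <= 1 -> absc (U p z) <= B,
  forall p, p \in S -> jet (U p) p.1 (tau * p.2) &
  forall p q, p \in S -> q \in S -> p != q ->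
    exists2 a : R, 0 < a & forall z, absc z <= 1 -> a * absc z <= absc (U p z - U q z)].

Variable S : seq (C * C).
Hypotheses (S0 : (0, 0) \in S) (Sstep : forall p, p \in S -> tangent_step p \in S)
  (Scrit : forall p, p \in S -> p.1 = 0 -> p = (0, 0)).

Lemma tangent_step0 : tangent_step (0, 0) = (c, w1).
Proof. by rewrite /tangent_step /= mulr0 mul0r addr0 expr0n gtn_eqF ?add0r // ltnW. Qed.

(** Away from the critical point the derivative of the step is invertible on
    tangent vectors. *)
Lemma tangent_step_inj_fiber p q : p \in S -> q \in S -> tangent_step p = tangent_step q ->
  p.1 = q.1 -> p = q.
Proof.
move=> pS qS [_ h2] h1; have [p0|p0] := eqVneq p.1 0.
  by rewrite (Scrit pS p0) (Scrit qS) // -h1.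
move: h2; rewrite -h1 => /addrI/(mulIf (invr_neq0 mu0)).
have dp0 : d%:R * p.1 ^+ d.-1 != 0.
  by rewrite mulf_neq0 ?expf_neq0 // pnatr_eq0 -lt0n ltnW.
by move/(mulfI dp0); case: p q h1 {pS qS p0 dp0} => [? ?] [? ?] /= -> ->.
Qed.

(** The root of [U (step p) - U (step 0)] is chosen as a function of [step p] alone
    and then multiplied by the point [p.1]. Two points with the same image thus
    move proportionally, and remain separated. The bound [B] persists since
    [2 B <= B ^ d]. *)
Lemma motion_lift B tau U : 2 <= B -> holomorphic_motion S B tau U ->
  exists V, holomorphic_motion S B (tau / mu) V.
Proof.
move=> B2 [Udisc UB Ujet Usep]; have d0 := ltnW d2.
have cS : (c, w1) \in S by rewrite -tangent_step0 Sstep.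
have [|W Wroot] := @choice (C * C) (C -> C) (fun q W => q \in S -> q.1 != c ->
    [/\ disc_algebra W, W 0 = 1,
      forall z, absc z <= 1 -> W z ^+ d = (q.1 - c)^-1 * (U q z - U (c, w1) z) &
      exists2 b : R, 0 < b & forall z, absc z <= 1 -> b <= absc (W z)]).
  move=> q; have [qS|_] := boolP (q \in S); last by exists id.
  have [_|qc] := eqVneq q.1 c; first by exists id.
  have qc0 : q.1 - c != 0 by rewrite subr_eq0.
  have aqc0 : 0 < absc (q.1 - c)^-1 by rewrite absc_gt0 invr_eq0.
  pose F z := (q.1 - c)^-1 * (U q z - U (c, w1) z).
  have hF : disc_algebra F.
    by apply: disc_algebraZ; apply: disc_algebraB; apply: Udisc.
  have F0 : F 0 = 1.
    by rewrite /F (jet_at0 (Ujet q qS)) (jet_at0 (Ujet _ cS)) mulVf.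
  have qneq : q != (c, w1) by apply: contra_neq qc => ->.
  have [a a0 Ua] := Usep q _ qS cS qneq.
  have [||z z1|b b0 Fb] := @disc_algebra_away0 _ F (absc (q.1 - c)^-1 * a) hF.
  - by rewrite F0 oner_eq0.
  - by rewrite mulr_gt0.
  - by rewrite /F abscM -mulrA ler_pM2l // Ua.
  have [W [hW W0 WF]] := disc_algebra_root d0 hF F0 b0 Fb.
  exists W => _ _; split => //; exists (Num.min 1 b) => [|z z1].
    by rewrite lt_min ltr01.
  rewrite ge_min; have [//|W1] := lerP 1 (absc (W z)).
  apply: le_trans (Fb z z1) _; rewrite -WF // abscX -{2}[absc _]expr1.
  by rewrite ler_wiXn2l ?absc_ge0 ?ltW.
pose V p z := p.1 * W (tangent_step p) z.
have tneq p : p.1 != 0 -> (tangent_step p).1 != c.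
  by move=> p0; rewrite /= -subr_eq0 addrK expf_neq0.
have Wp p (pS : p \in S) (p0 : p.1 != 0) :=
  Wroot (tangent_step p) (Sstep pS) (tneq p p0).
have VE p z : p \in S -> absc z <= 1 -> V p z ^+ d = U (tangent_step p) z - U (c, w1) z.
  move=> pS z1; have [p0|p0] := eqVneq p.1 0.
    by rewrite (Scrit pS p0) tangent_step0 subrr /V mul0r expr0n gtn_eqF.
  have [_ _ WE _] := Wp p pS p0.
  by rewrite /V exprMn WE //= addrK mulVKf ?expf_neq0.
have Vdisc p : p \in S -> disc_algebra (V p).
  move=> pS; have [p0|p0] := eqVneq p.1 0.
    by apply: (eq_disc_algebra _ (disc_algebra_cst 0)) => z _; rewrite /V p0 mul0r.
  by have [hW _ _ _] := Wp p pS p0; apply: disc_algebraZ.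
have VB p z : p \in S -> absc z <= 1 -> absc (V p z) <= B.
  move=> pS z1; have B0 : 0 <= B by lra.
  rewrite -(@ler_pXn2r _ d) ?nnegrE ?absc_ge0 // -abscX VE //.
  apply: le_trans (abscB _ _) _.
  apply: le_trans (lerD (UB _ _ (Sstep pS) z1) (UB _ _ cS z1)) _.
  apply: (@le_trans _ _ (B ^+ 2)); last by rewrite ler_eXn2l //; lra.
  by rewrite expr2; nra.
exists V; split => //.
- move=> p pS; have [p0|p0] := eqVneq p.1 0.
    rewrite (Scrit pS p0) /= mulr0.
    apply: (eq_jet _ (jet_affine 0 0)) => z _.
    by rewrite /V /= !mul0r addr0.
  have [_ W0 _ _] := Wp p pS p0.
  apply: (jet_root (Vdisc p pS) d0 p0); first by rewrite /V W0 mulr1.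
  apply: (eq_jet (VE p ^~ pS)).
  have -> : d%:R * p.1 ^+ d.-1 * (tau / mu * p.2) =
      tau * (tangent_step p).2 - tau * w1 by rewrite /=; field.
  have -> : p.1 ^+ d = (tangent_step p).1 - c by rewrite /= addrK.
  exact: jetB (Ujet _ (Sstep pS)) (Ujet _ cS).
- move=> p q pS qS pq; have [eqs|neqs] := eqVneq (tangent_step p) (tangent_step q).
    (* [V p - V q] is [p.1 - q.1] times a common factor that is bounded below *)
    have pq1 : p.1 != q.1 by apply: contra_neq pq; apply: tangent_step_inj_fiber.
    have p0 : p.1 != 0.
      apply: contra_neq pq1 => p0; have [/eqP] := eqs; rewrite p0.
      by rewrite expr0n gtn_eqF // add0r -subr_eq0 opprD addrCA subrr addr0
        oppr_eq0 expf_eq0 d0 => /eqP ->.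
    have [_ _ _ [b b0 Wb]] := Wp p pS p0.
    exists (absc (p.1 - q.1) * b) => [|z z1].
      by rewrite mulr_gt0 // absc_gt0 subr_eq0.
    rewrite /V -eqs -mulrBl abscM -mulrA ler_wpM2l ?absc_ge0 //.
    by apply: le_trans (Wb z z1); rewrite ler_piMr // ltW.
  have [a a0 Ua] := Usep _ _ (Sstep pS) (Sstep qS) neqs.
  have dB0 : 0 < d%:R * B ^+ d.-1 by rewrite mulr_gt0 ?ltr0n ?exprn_gt0 //; lra.
  exists (a / (d%:R * B ^+ d.-1)) => [|z z1]; first by rewrite divr_gt0.
  rewrite mulrAC ler_pdivrMr //; apply: le_trans (Ua z z1) _.
  have -> : U (tangent_step p) z - U (tangent_step q) z = V p z ^+ d - V q z ^+ d.
    by rewrite !VE //; ring.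
  rewrite subrXX abscM ler_wpM2l ?absc_ge0 //.
  apply: le_trans (absc_sum _ _ _) _.
  rewrite mulr_natl -[X in _ *+ X]card_ord -sumr_const; apply: ler_sum => i _.
  have iE : (d.-1 - i + i = d.-1)%N by rewrite subnK // -ltnS prednK.
  rewrite -[in leRHS]iE exprD abscM !abscX.
  by apply: ler_pM; rewrite ?exprn_ge0 ?absc_ge0 // lerXn2r ?nnegrE ?absc_ge0 ?VB //; lra.
Qed.

(** Straight lines with small velocities: points that are distinct at the centre
    do not meet over the disc. *)
Lemma exists_motion : exists B tau U, [/\ 2 <= B, tau != 0 & holomorphic_motion S B tau U].
Proof.
pose f (pq : (C * C) * (C * C)) : R := if pq.1.1 == pq.2.1 then 1 else
  absc (pq.1.1 - pq.2.1) / (2 * (absc (pq.1.2 - pq.2.2) + 1)).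
have [|t t0 ft] := @exists_pos_lower_bound _ [seq (p, q) | p <- S, q <- S] f.
  move=> [p q] _; rewrite /f /=; case: eqVneq => // pq1.
  rewrite divr_gt0 ?absc_gt0 ?subr_eq0 //.
  by have := absc_ge0 (p.2 - q.2); lra.
have [B B2 UB] := exists_upper_bound S (fun p => absc p.1 + absc p.2 * t).
have at_ : absc t%:C = t by rewrite absc_real // ltW.
exists B, t%:C, (fun p z => p.1 + t%:C * p.2 * z); split => //.
  by rewrite -absc_eq0 at_ gt_eqF.
split.
- move=> p _; apply: (eq_disc_algebra _ (disc_algebra_poly (p.1%:P + (t%:C * p.2) *: 'X))).
  by move=> z _; rewrite !hornerE.
- move=> p z pS z1; apply: le_trans (UB p pS); apply: le_trans (abscD _ _) _.
  rewrite lerD2l !abscM at_ [t * _]mulrC ler_piMr //.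
  by rewrite mulr_ge0 ?absc_ge0 // ltW.
- by move=> p _; apply: jet_affine.
- move=> p q pS qS pq.
  have UE z : p.1 + t%:C * p.2 * z - (q.1 + t%:C * q.2 * z) =
    (p.1 - q.1) + t%:C * (p.2 - q.2) * z by ring.
  have := ft (p, q) (allpairs_f _ pS qS); rewrite /f /=.
  have [e1 _|n1 tf] := eqVneq p.1 q.1.
    have e2 : p.2 != q.2.
      by apply: contra_neq pq; case: p q e1 {pS qS UE} => [? ?] [? ?] /= -> ->.
    exists (t * absc (p.2 - q.2)) => [|z z1].
      by rewrite mulr_gt0 // absc_gt0 subr_eq0.
    by rewrite UE e1 subrr add0r !abscM at_.
  have p0 : 0 < absc (p.1 - q.1) by rewrite absc_gt0 subr_eq0.
  exists (absc (p.1 - q.1) / 2) => [|z z1]; first by lra.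
  have a0 := absc_ge0 (p.2 - q.2).
  move: tf; rewrite ler_pdivlMr; last by lra.
  move=> tf; rewrite UE -[t%:C * _ * z]opprK; apply: le_trans (abscB_ge _ _).
  rewrite abscN !abscM at_.
  have h1 : t * absc (p.2 - q.2) * absc z <= t * absc (p.2 - q.2).
    by rewrite ler_piMr // mulr_ge0 // ltW.
  have h2 : absc (p.1 - q.1) / 2 * absc z <= absc (p.1 - q.1) / 2.
    by rewrite ler_piMr //; lra.
  by have := absc_ge0 z; nra.
Qed.

(** Lifting [n] times divides the velocities by [mu ^ n] and keeps the bound [B]:
    for [absc mu < 1] this contradicts Cauchy's estimate. *)
Lemma tangent_expanding p : p \in S -> p.2 != 0 -> 1 <= absc mu.
Proof.
move=> pS p2; have [B [tau [U [B2 tau0 motU]]]] := exists_motion.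
have lifts n : exists U, holomorphic_motion S B (tau / mu ^+ n) U.
  elim: n => [|n [Un motUn]]; first by exists U; rewrite expr0 divr1.
  have [V motV] := motion_lift B2 motUn.
  by exists V; rewrite exprSr invfM mulrA.
rewrite leNgt; apply/negP => mu1.
have a0 : 0 < absc tau * absc p.2 by rewrite mulr_gt0 ?absc_gt0.
have [|||n] := @exists_small_pow R (absc mu) (absc tau * absc p.2 / (B + 1)).
- exact: absc_ge0.
- exact: mu1.
- by rewrite divr_gt0 //; lra.
have [V [Vdisc VB Vjet _]] := lifts n.
have := disc_algebra_jet_le (Vdisc p pS) (Vjet p pS) (fun z => VB p z pS).
rewrite !abscM abscV abscX mulrAC.
have mun : 0 < absc mu ^+ n by rewrite exprn_gt0 // absc_gt0.
rewrite ler_pdivrMr // ler_pdivlMr; last by lra.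
by nra.
Qed.

End HolomorphicMotion.

(** * The marked critical orbit *)

Section CriticalOrbit.
Variable R : realType.
Local Notation C := R[i].
Variables (d : nat) (c w1 mu beta : C) (k m : nat).
Hypotheses (d2 : (1 < d)%N) (mu0 : mu != 0) (m0 : (0 < m)%N).
Hypotheses (betad : beta ^+ d = 1) (beta1 : beta != 1).
Local Notation step := (tangent_step d c w1 mu).

Definition tangent_orbit i : C * C := iter i step (0, 0).
Local Notation P := tangent_orbit.

Hypothesis closing : P k = (beta * (P (k + m)).1, beta * (P (k + m)).2).

Lemma tangent_orbitS i : P i.+1 = step (P i).
Proof. by []. Qed.

Lemma tangent_orbit_period a j b : P (j + a) = P j ->
  forall l, P (j + b + l * a) = P (j + b).
Proof.
move=> ja; have shift i : P (j + i + a) = P (j + i).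
  have -> : (j + i + a = i + (j + a))%N by lia.
  by rewrite [(j + i)%N]addnC /P iterD [RHS]iterD -/(P (j + a)) ja.
elim=> [|l IH]; first by rewrite addn0.
have -> : (j + b + l.+1 * a = j + (b + l * a) + a)%N by rewrite mulSn; lia.
by rewrite shift addnA.
Qed.

(** Both components of the step take the same value at [p] and at [beta * p],
    because [beta ^ d = 1]. *)
Lemma tangent_orbit_closed : P k.+1 = P (k.+1 + m).
Proof.
have db : beta ^+ d.-1 * beta = 1 by rewrite -exprSr prednK // ltnW.
rewrite addSn !tangent_orbitS closing /tangent_step /= exprMn betad mul1r.
congr (_, _); congr (_ + _ / _); rewrite exprMn.
by rewrite -[RHS]mul1r -db; ring.
Qed.

(** If the orbit of points returns to the critical point after [a] steps, the whole
    marked orbit is [a]-periodic from index 1 on, whatever the vector at [a].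
    Compared with the period [m], this gives [P k = P (k + m)] if [k > 0], whence both are
    0 as [beta] is not 1, and for [k = 0] they are 0 by closing; then [k + m] is a period too, and [P a = P (a * (k + m)) = 0]. *)
Lemma tangent_orbit_crit i : (P i).1 = 0 -> P i = (0, 0).
Proof.
have crit_period a : (P a).1 = 0 -> P (1 + a) = P 1.
  move=> Pa; rewrite add1n !tangent_orbitS /tangent_step Pa /=.
  by rewrite [0 ^+ d.-1]expr0n -subn1 subn_eq0 leqNgt d2 mulr0 !mul0r.
case: i => [//|i] Pi; set a := i.+1.
have Pn : P (k + m) = (0, 0).
  have [k0|k0] := posnP k.
    move: closing; rewrite k0 => -[/eqP h1 /eqP h2].
    have b0 : beta != 0.
      by apply: contra_eq_neq betad => ->; rewrite expr0n gtn_eqF ?(ltnW d2) // eq_sym oner_eq0.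
    move: h1 h2; rewrite ![0 == _]eq_sym !mulf_eq0 (negPf b0) /=.
    by case: (P _) => x y /= /eqP -> /eqP ->.
  have h1 : P (1 + k.-1 + m * a) = P (1 + k.-1) by apply/tangent_orbit_period/crit_period.
  have h2 : P (k.+1 + m.-1 + i * m) = P (k.+1 + m.-1).
    by apply/tangent_orbit_period; rewrite -tangent_orbit_closed.
  have PkPn : P (k + m) = P k.
    have e1 : (1 + k.-1 = k)%N by lia.
    have e2 : (k.+1 + m.-1 = k + m)%N by lia.
    rewrite e1 in h1; rewrite e2 in h2; rewrite -h1 -h2; congr P.
    by rewrite /a mulnS mulnC addnA.
  have fix0 (x : C) : x = beta * x -> x = 0.
    move/eqP; rewrite -subr_eq0 -{1}[x]mul1r -mulrBl mulf_eq0 subr_eq0 eq_sym.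
    by rewrite (negPf beta1) => /eqP.
  move: closing; rewrite PkPn; case: (P k) => x y /= [/fix0 -> /fix0 ->].
  by [].
have h1 : P (1 + i + (k + m).-1 * a) = P (1 + i) by apply/tangent_orbit_period/crit_period.
have h2 : P (1 + (k + m).-1 + i * (k + m)) = P (1 + (k + m).-1).
  by apply/tangent_orbit_period/crit_period; rewrite Pn.
have e1 : (1 + (k + m).-1 = k + m)%N by rewrite add1n prednK // addn_gt0 m0 orbT.
rewrite -[LHS]/(P (1 + i)) -h1 -Pn -[in RHS]e1 -h2 /a -[X in (i * X)%N]e1; congr P.
by rewrite mulnS mulnDr muln1 (mulnC i); lia.
Qed.

Lemma tangent_orbit_expanding : w1 != 0 -> 1 <= absc mu.
Proof.
move=> w10; pose S := [seq P i | i <- iota 0 (k + m).+1].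
have PS i : (i <= k + m)%N -> P i \in S.
  by move=> ikm; apply: map_f; rewrite mem_iota add0n ltnS.
have d0 := ltnW d2.
apply: (@tangent_expanding _ d c w1 mu d2 mu0 S _ _ _ (P 1)) => //.
- exact: (PS 0%N).
- move=> p /mapP [] i; rewrite mem_iota add0n ltnS /= => ikm ->; rewrite -tangent_orbitS.
  have [->|ne] := eqVneq i (k + m)%N; last by apply: PS; lia.
  by rewrite -addSn -tangent_orbit_closed; apply: PS; lia.
- by move=> p /mapP [] i _ ->; apply: tangent_orbit_crit.
- by apply: PS; lia.
- by rewrite tangent_orbitS /tangent_step /= mulr0 mul0r addr0.
Qed.

End CriticalOrbit.

(** * Integrality *)

Section AlgebraicIntegers.
Variable R : realType.
Local Notation C := R[i].
Implicit Types x y : C.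

Local Notation integral := (integralOver (intr : int -> C)).

Lemma integral_exp x n : integral x -> integral (x ^+ n).
Proof.
move=> hx; elim: n => [|n IH]; first by rewrite expr0; apply: integral1.
by rewrite exprS; apply: integral_mul.
Qed.

Lemma integral_sum (I : Type) (r : seq I) (F : I -> C) :
  (forall i, integral (F i)) -> integral (\sum_(i <- r) F i).
Proof.
move=> hF; elim/big_ind: _ => //; [exact: mxpoly.integral0|exact: integral_add].
Qed.

Lemma integral_unity_root x n : (0 < n)%N -> x ^+ n = 1 -> integral x.
Proof.
move=> n0 xn; exists ('X^n - 1); first by rewrite monicXnsubC.
by rewrite rmorphB rmorphXn /= map_polyX rmorph1 rootE !hornerE xn subrr.
Qed.

Lemma integral_conj x : integral x -> integral x^*.
Proof.
case=> p pm px; exists p => //.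
have -> : map_poly (intr : int -> C) p = map_poly (@conjc R) (map_poly intr p).
  rewrite -map_poly_comp; apply: eq_map_poly => z /=; by rewrite rmorph_int.
by rewrite rootE horner_map (eqP px) rmorph0.
Qed.

(** The rational root theorem. *)
Lemma integral_frac (a b : nat) : (0 < b)%N -> coprime b a ->
  integral (a%:R / b%:R) -> b = 1%N.
Proof.
move=> b0 cab [p pm]; have bC : b%:R != 0 :> C by rewrite pnatr_eq0 -lt0n.
have [N sN] : exists N, size p = N.+1.
  by exists (size p).-1; rewrite prednK // lt0n size_poly_eq0 monic_neq0.
rewrite rootE => /eqP rt.
have pN : p`_N = 1 by rewrite -(monicP pm) lead_coefE sN.
(* clear denominators in the equation satisfied by [a / b] *)
have : a%:R ^+ N = - (b%:R * \sum_(i < N) p`_i * a%:R ^+ i * b%:R ^+ (N - i.+1)) :> int.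
  apply/eqP; rewrite -addr_eq0; apply/eqP/(@intr_inj C); rewrite rmorph0.
  transitivity (b%:R ^+ N * (map_poly (intr : int -> C) p).[a%:R / b%:R]).
    rewrite horner_coef size_map_inj_poly ?rmorph0 //; last exact: intr_inj.
    rewrite sN big_ord_recr /= coef_map /= pN mulrDr [RHS]addrC rmorphD.
    rewrite rmorphM rmorph_sum rmorphXn /= !rmorph_nat mul1r expr_div_n.
    congr (_ + _); first by rewrite mulrCA divff ?mulr1 // expf_neq0.
    rewrite !mulr_sumr; apply: eq_bigr => i _; rewrite coef_map /=.
    rewrite !rmorphM !rmorphXn /= !rmorph_nat expr_div_n.
    have -> : b%:R ^+ N = b%:R ^+ i * (b%:R * b%:R ^+ (N - i.+1)) :> C.
      by rewrite -exprS -exprD; congr (_ ^+ _); have := ltn_ord i; lia.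
    by field; rewrite expf_neq0.
  by rewrite rt mulr0.
rewrite -natrX !natz => /(congr1 absz); rewrite abszN abszM /= => abN.
have : coprime b (a ^ N) by apply: coprimeXr.
by rewrite abN coprimeMr /coprime gcdnn => /andP[/eqP].
Qed.

Lemma integral_monic_eq (mu : C) N (q : {poly C}) : (size q <= N)%N ->
  (forall i, integral q`_i) -> mu ^+ N = q.[mu] -> integral mu.
Proof.
move=> sq qi muN; apply: (@integral_root_monic _ _ _ mu ('X^N - q)).
- rewrite monicE lead_coefDl ?lead_coefXn //.
  by rewrite size_polyN size_polyXn ltnS.
- by rewrite rootE !hornerE muN subrr.
- apply/integral_poly => i; rewrite coefB; apply: integral_sub => //.
  by rewrite coefXn; apply: integral_nat.
Qed.

End AlgebraicIntegers.

(** * Arithmetic of the eigenvalues *)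

Section UnitCircle.
Variable R : realType.
Local Notation C := R[i].
Local Notation integral := (integralOver (intr : int -> C)).

Variables (d : nat) (beta mu : C) (k m : nat) (u t : nat -> C).
Hypotheses (d2 : (1 < d)%N) (m0 : (0 < m)%N).
Hypotheses (betad : beta ^+ d = 1) (beta1 : beta != 1) (mu0 : mu != 0).
Hypotheses (u0 : u 0%N = 0) (uS : forall i, u i.+1 = u i ^+ d + u 1%N)
  (uk : u k = beta * u (k + m)%N).
(** [t] is the family of tangent vectors normalised by [t 1 = 1]. *)
Hypotheses (t0 : t 0%N = 0) (tS : forall i, t i.+1 = 1 + d%:R * u i ^+ d.-1 * t i / mu)
  (tk : t k = beta * t (k + m)%N).

Let integral_beta : integral beta.
Proof. exact: integral_unity_root (ltnW d2) betad. Qed.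

Let beta0 : beta != 0.
Proof.
apply: contra_eq_neq betad => ->.
by rewrite expr0n gtn_eqF ?(ltnW d2) // eq_sym oner_eq0.
Qed.

Let km_succ : exists n, (k + m = n.+1)%N.
Proof. by exists (k + m).-1; rewrite prednK // addn_gt0 m0 orbT. Qed.

Let d0 : (0 < d)%N := ltnW d2.

Let dC : d%:R != 0 :> C.
Proof. by rewrite pnatr_eq0 -lt0n. Qed.

Lemma beta_geometric_sum : \sum_(j < d) beta ^+ j = 0.
Proof.
apply/eqP; have := subrX1 beta d; rewrite betad subrr => /esym/eqP.
by rewrite mulf_eq0 subr_eq0 (negPf beta1).
Qed.

(** Subtracting [d] from the vanishing sum of the [beta ^ j] term by term
    produces multiples of [1 - beta]. *)
Lemma integral_d_div_beta1 : integral (d%:R / (1 - beta)).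
Proof.
have b1 : 1 - beta != 0 by rewrite subr_eq0 eq_sym.
have -> : d%:R / (1 - beta) = \sum_(j < d) \sum_(i < j) beta ^+ i.
  apply: (mulIf b1); rewrite divfK // mulr_suml.
  have -> : d%:R = \sum_(j < d) (1 - beta ^+ j).
    by rewrite sumrB beta_geometric_sum subr0 sumr_const card_ord.
  apply: eq_bigr => j _; have := subrX1 beta j => h.
  by rewrite -[LHS]opprB h; ring.
by apply: integral_sum => j; apply: integral_sum => i; apply: integral_exp.
Qed.

(** [u j] is a polynomial in [c = u 1] with integer coefficients, monic of
    degree [d ^ (j - 1)]; the closing relation is therefore an integral equation
    for [c], up to the unit [beta]. *)
Lemma integral_u i : integral (u i).
Proof.
pose q j := iter j (fun p : {poly int} => p ^+ d + 'X) 0.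
have qu j : (map_poly (intr : int -> C) (q j)).[u 1%N] = u j.
  elim: j => [|j IH]; first by rewrite rmorph0 horner0 u0.
  by rewrite /q iterS -/(q j) rmorphD rmorphXn /= map_polyX hornerD horner_exp IH
    hornerX -uS.
have qm j : q j.+1 \is monic /\ size (q j.+1) = (d ^ j).+1.
  elim: j => [|j [qm qs]].
    by rewrite /q /= expr0n gtn_eqF ?(ltnW d2) // add0r monicX size_polyX.
  have sX : size (q j.+1 ^+ d) = (d ^ j.+1).+1.
    have := size_exp (q j.+1) d; rewrite qs /= -expnSr => <-.
    by rewrite prednK // size_poly_gt0 monic_neq0 // monic_exp.
  have lt : (size ('X : {poly int}) < size (q j.+1 ^+ d)) %N.
    rewrite sX size_polyX ltnS; apply: leq_trans d2 _.
    by rewrite -{1}(expn1 d) leq_exp2l.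
  rewrite -[q j.+2]/(q j.+1 ^+ d + 'X) size_polyDl //; split => //.
  by rewrite monicE lead_coefDl // -monicE monic_exp.
have intc : integral (u 1%N).
  have [n kmn] := km_succ.
  pose f : {poly int} -> {poly C} := map_poly intr.
  have fq p : size (f p) = size p by rewrite size_map_inj_poly ?rmorph0 //; exact: intr_inj.
  apply: (@integral_root_monic _ _ _ _ (f (q (k + m)%N) - beta^-1 *: f (q k))).
  - have [qnm qns] := qm n.
    have fm : f (q n.+1) \is monic by apply: monic_map.
    rewrite kmn monicE lead_coefDl -?monicE //.
    rewrite size_polyN (leq_ltn_trans (size_scale_leq _ _)) // !fq qns.
    case: (k) (kmn) => [_|k' kn]; first by rewrite size_poly0.
    by have [_ ->] := qm k'; rewrite ltnS ltn_exp2l; lia.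
  - by rewrite rootE hornerD hornerN hornerZ /f !qu uk mulKf ?subrr.
  - apply/integral_poly => j; rewrite coefB coefZ !coef_map /=.
    apply: integral_sub; first exact: integral_id.
    apply: integral_mul; last exact: integral_id.
    suff -> : beta^-1 = beta ^+ d.-1 by apply: integral_exp.
    by apply: (mulfI beta0); rewrite divff // -exprS prednK ?betad // ltnW.
elim: i => [|i IH]; first by rewrite u0; apply: mxpoly.integral0.
by rewrite uS; apply/integral_add/intc/integral_exp.
Qed.

(** The recursion makes [t (j + 1)] a polynomial in [1 / mu] with constant
    term 1 and all other coefficients multiples of [d]. *)
Lemma t_lower j : exists p : {poly C}, [/\ (size p <= j)%N, forall i, integral p`_i &
  mu ^+ j * t j.+1 = mu ^+ j + d%:R * p.[mu]].
Proof.
elim: j => [|j [p [sp pi pE]]].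
  exists 0; split; [by rewrite size_poly0|by move=> i; rewrite coef0; apply: mxpoly.integral0|].
  by rewrite horner0 tS t0 !mulr0 mul0r !addr0 mulr1.
exists (u j.+1 ^+ d.-1 *: ('X^j + d%:R *: p)); split.
- apply: leq_trans (size_scale_leq _ _) _; apply: leq_trans (size_polyD _ _) _.
  rewrite geq_max size_polyXn leqnn /=; apply: leq_trans (size_scale_leq _ _) _.
  exact: leqW.
- move=> i; rewrite coefZ coefD coefZ coefXn; apply: integral_mul.
    by apply/integral_exp/integral_u.
  by apply: integral_add; [|apply: integral_mul => //]; apply: integral_nat.
- rewrite hornerZ hornerD hornerZ hornerXn -pE tS exprS; field; exact: mu0.
Qed.

(** The closing relation for [t], multiplied by a power of [mu], is an equation for
    [mu] with leading coefficient 1 if [k = 0] and [1 - beta] otherwise, all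
    other coefficients being multiples of [d]; and [1 - beta] divides [d]. *)
Lemma integral_mu : integral mu.
Proof.
have [n kmn] := km_succ.
have [p [sp pi pE]] := t_lower n.
have b1 : 1 - beta != 0 by rewrite subr_eq0 eq_sym.
move: tk; rewrite kmn; case: (k) kmn => [|k'] kmn tkE.
  have tn : t n.+1 = 0.
    by move/esym/eqP: tkE; rewrite t0 mulf_eq0 (negPf beta0) => /eqP.
  apply: (@integral_monic_eq _ mu n (- (d%:R *: p))).
  - by rewrite size_polyN (leq_trans (size_scale_leq _ _)).
  - move=> i; rewrite coefN coefZ; apply/integral_opp/integral_mul => //.
    exact: integral_nat.
  - rewrite hornerN hornerZ; apply/eqP; rewrite -addr_eq0 -pE tn mulr0 //.
have [p' [sp' pi' pE']] := t_lower k'.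
have nE : n = (m + k')%N by lia.
apply: (@integral_monic_eq _ mu n (- (d%:R / (1 - beta)) *: ('X^m * p' - beta *: p))).
- rewrite (leq_trans (size_scale_leq _ _)) // (leq_trans (size_polyD _ _)) // geq_max.
  rewrite size_polyN (leq_trans (size_scale_leq _ _)) // andbT mulrC.
  have [->|p'0] := eqVneq p' 0; first by rewrite mul0r size_poly0.
  by rewrite size_mulXn // nE leq_add2l.
- move=> i; rewrite coefZ coefB coefZ coefXnM; apply: integral_mul.
    exact/integral_opp/integral_d_div_beta1.
  apply: integral_sub; last exact: integral_mul.
  by case: ifP => // _; apply: mxpoly.integral0.
- have : mu ^+ m * (mu ^+ k' * t k'.+1) = beta * (mu ^+ n * t n.+1).
    by rewrite mulrA -exprD -nE tkE; ring.
  rewrite pE pE' mulrDr -exprD -nE => h.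
  rewrite hornerZ hornerD hornerN hornerM hornerXn hornerZ.
  apply: (mulfI b1); rewrite mulrA mulrN mulrCA divff // mulr1.
  apply/eqP; rewrite -subr_eq0; apply/eqP.
  transitivity (mu ^+ n + mu ^+ m * (d%:R * p'.[mu]) -
    beta * (mu ^+ n + d%:R * p.[mu])); first by ring.
  by rewrite h subrr.
Qed.

(** * Eigenvalues on the unit circle *)

Hypothesis amu : absc mu = 1.

Let r i := u i ^+ d.-1 * t i / mu.

(** On the unit circle the inverse is the complex conjugate, and conjugation
    preserves algebraic integers: [mu] is a unit. *)
Lemma integral_mu_inv : integral mu^-1.
Proof.
have -> : mu^-1 = mu^*.
  by apply: (mulfI mu0); rewrite divff // -sqr_normc abscE amu expr1n.
exact/integral_conj/integral_mu.
Qed.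

Lemma t_congr1 i : t i.+1 = 1 + d%:R * r i.
Proof. by rewrite tS /r; ring. Qed.

Lemma integral_t i : integral (t i).
Proof.
have inu := integral_mu_inv.
elim: i => [|i IH]; first by rewrite t0; apply: mxpoly.integral0.
rewrite tS; apply: integral_add; first exact: integral1.
do 3?[apply: integral_mul => //]; first exact: integral_nat.
exact/integral_exp/integral_u.
Qed.

Lemma integral_r i : integral (r i).
Proof.
apply: integral_mul integral_mu_inv; apply: integral_mul (integral_t i).
exact/integral_exp/integral_u.
Qed.

(** When [k] is 0 the closing relation reads [t (k + m) = 0], although [t] is
    congruent to 1 modulo [d]. *)
Lemma preperiod_gt0 : (0 < k)%N.
Proof.
rewrite lt0n; apply/eqP => k0; have [n kmn] := km_succ.
have h : 1 + d%:R * r n = 0.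
  by move/esym/eqP: tk; rewrite kmn k0 t0 t_congr1 mulf_eq0 (negPf beta0) => /eqP.
have : integral (1%:R / d%:R).
  have -> : 1%:R / d%:R = - r n; last exact/integral_opp/integral_r.
  apply: (mulIf dC); rewrite divfK //; apply/eqP; rewrite -subr_eq0; apply/eqP.
  by rewrite -h; ring.
by move/(integral_frac d0 (coprimen1 _)) => d1; move: d2; rewrite d1.
Qed.

(** As [k > 0], both [t k] and [t (k + m)] are 1 modulo [d]. *)
Lemma beta_congr1 : exists2 th, integral th & beta = 1 + d%:R * th.
Proof.
have [n kmn] := km_succ.
have [k' kE] : exists k', k = k'.+1 by exists k.-1; rewrite prednK ?preperiod_gt0.
exists (r k' - beta * r n).
  apply: integral_sub; first exact: integral_r.
  by apply: integral_mul => //; apply: integral_r.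
have : beta = 1 + d%:R * r k' - beta * (d%:R * r n).
  by move: tk; rewrite kmn kE !t_congr1 => ->; ring.
by move=> {1}->; ring.
Qed.

(** With [beta = 1 + d th], the sum of the [beta ^ j] for [j < d] has the form
    [d (1 + th d (d - 1) / 2 + d x)], where [x] is an algebraic integer. The sum
    vanishes, and doubling the second factor shows that [d] divides 2. *)
Lemma integral_two_div_d : integral (2%:R / d%:R).
Proof.
have [th ith betaE] := beta_congr1.
pose g j := \sum_(i < j) \sum_(l < i) beta ^+ l.
have ig j : integral (g j).
  by apply: integral_sum => i; apply: integral_sum => l; apply: integral_exp.
have sb i : beta ^+ i = 1 + d%:R * th * \sum_(l < i) beta ^+ l.
  by have := subrX1 beta i; rewrite {2}betaE addrAC subrr add0r => <-; ring.
have bj j : beta ^+ j = 1 + d%:R * th * (j%:R + d%:R * th * g j).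
  rewrite sb; congr (_ + _ * _); rewrite /g mulr_sumr.
  have -> : (j%:R : C) = \sum_(i < j) 1 by rewrite sumr_const card_ord.
  by rewrite -big_split /=; apply: eq_bigr => i _; rewrite sb.
have : d%:R * (1 + th * (\sum_(j < d) j%:R + d%:R * th * \sum_(j < d) g j)) = 0.
  rewrite -[RHS]beta_geometric_sum; under [RHS]eq_bigr => j _ do rewrite bj.
  by rewrite big_split /= sumr_const card_ord -mulr_sumr big_split /= -mulr_sumr; ring.
move/eqP; rewrite mulf_eq0 (negPf dC) /= => /eqP h.
have sj : 2 * \sum_(j < d) j%:R = d%:R * d.-1%:R :> C.
  elim: (d) => [|e IH]; first by rewrite big_ord0 mulr0 mul0r.
  rewrite big_ord_recr /= mulrDr IH; case: (e) => [|e']; first by ring.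
  by rewrite /= -!(natr1 _); ring.
have -> : 2%:R / d%:R = - (th * (d.-1%:R + 2 * th * \sum_(j < d) g j)).
  apply: (mulIf dC); rewrite divfK //; apply/eqP; rewrite -subr_eq0.
  have -> : 2%:R - - (th * (d.-1%:R + 2 * th * \sum_(j < d) g j)) * d%:R =
     2%:R * (1 + th * (\sum_(j < d) j%:R + d%:R * th * \sum_(j < d) g j))
     + th * (d%:R * d.-1%:R - 2 * \sum_(j < d) j%:R) by ring.
  by rewrite h sj subrr !mulr0 addr0.
apply/integral_opp/integral_mul => //; apply: integral_add; first exact: integral_nat.
apply: integral_mul; last exact: integral_sum.
by apply: integral_mul => //; apply: integral_nat.
Qed.

Lemma degree_eq2 : d = 2%N.
Proof.
have i2d := integral_two_div_d; have [od|ed] := boolP (odd d).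
  have := integral_frac d0 (_ : coprime d 2) i2d.
  by rewrite coprimen2 od => /(_ isT) d1; move: d2; rewrite d1.
have dh : d = (d./2 * 2)%N by rewrite muln2 even_halfK.
have h0 : (0 < d./2)%N by move: d0; rewrite {1}dh muln_gt0 => /andP [].
have : integral (1%:R / d./2%:R).
  have -> : 1%:R / d./2%:R = 2%:R / d%:R :> C; last by [].
  rewrite {2}dh natrM; field.
  by rewrite pnatr_eq0 -lt0n h0.
by move/(integral_frac h0) => h; rewrite dh h ?coprimen1.
Qed.

(** In degree 2 the congruences have to be refined modulo 4. Put
    [s = u (k - 1) + u (k + m - 1)]; the closing relation for [t] becomes
    [1 + s / mu = 0] modulo 2, while the one for [u] makes [s ^ 2] a multiple of 2:
    hence 1 is a multiple of 2. *)
Lemma unimodular_absurd : False.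
Proof.
have dE := degree_eq2; pose nu := mu^-1; have inu : integral nu := integral_mu_inv.
have two : (2 : C) != 0 by rewrite pnatr_eq0.
have [n kmn] := km_succ.
have [k' kE] : exists k', k = k'.+1 by exists k.-1; rewrite prednK ?preperiod_gt0.
have betaN : beta = -1.
  by move/eqP: betad; rewrite dE sqrf_eq1 (negPf beta1) => /eqP.
have rE i : r i = u i * t i * nu by rewrite /r dE expr1.
have t2 i : t i.+1 = 1 + 2 * r i by rewrite t_congr1 dE.
have u2 i : u i.+1 = u i ^+ 2 + u 1%N by rewrite -dE.
have r2 i : exists2 y, integral y & r i = u i * nu + 2 * y.
  case: i => [|i].
    by exists 0; [exact: mxpoly.integral0|rewrite rE u0 !mul0r mulr0 addr0].
  exists (u i.+1 * r i * nu); last by rewrite rE t2; ring.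
  apply: integral_mul inu; apply: integral_mul (integral_r i); exact: integral_u.
have [[y iy yE] [y' iy' yE']] := (r2 k', r2 n).
pose s := u k' + u n.
have key : 1 + s * nu = 2 * (- (y + y')).
  apply: (mulfI two); apply/eqP; rewrite -subr_eq0; apply/eqP.
  have := tk; rewrite kmn kE !t2 yE yE' betaN => h.
  transitivity (1 + 2 * (u k' * nu + 2 * y) - -1 * (1 + 2 * (u n * nu + 2 * y'))).
    by rewrite /s; ring.
  by rewrite h subrr.
have s2 : s ^+ 2 = 2 * (u k' * u n - u 1%N).
  have := uk; rewrite kmn kE (u2 k') (u2 n) betaN => h.
  apply/eqP; rewrite -subr_eq0; apply/eqP.
  transitivity (u k' ^+ 2 + u 1%N - -1 * (u n ^+ 2 + u 1%N)); first by rewrite /s; ring.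
  by rewrite h subrr.
have : integral (1%:R / 2%:R).
  have -> : 1%:R / 2%:R = (u k' * u n - u 1%N) * nu ^+ 2 -
       2 * (y + y') * (1 + (y + y')).
    apply: (mulIf two); rewrite divfK //.
    have e1 : s * nu = - 1 - 2 * (y + y') by apply: (addrI 1); rewrite key; ring.
    have : (s * nu) ^+ 2 = 2 * (u k' * u n - u 1%N) * nu ^+ 2 by rewrite exprMn s2.
    rewrite e1 => e2; rewrite mulrBl [_ * nu ^+ 2 * 2]mulrC mulrA -e2; ring.
  apply: integral_sub; apply: integral_mul.
  - by apply: integral_sub; [apply: integral_mul|]; apply: integral_u.
  - exact: integral_exp.
  - by apply: integral_mul; [exact: integral_nat|exact: integral_add].
  - by apply: integral_add; [exact: integral1|exact: integral_add].
by move/(@integral_frac R 1 2 isT isT).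
Qed.

End UnitCircle.

(** * Differential of the Koch maps *)

Section Differential.
Variable K : numFieldType.

Lemma is_diff_xcoord n (z : 'rV[K]_n) i :
  is_diff z (fun x : 'rV[K]_n => xcoord x i : K) (fun v => xcoord v i).
Proof.
case: i => [|j] /=; first exact: is_diff_cst.
case: (insub j) => [j' |]; last exact: is_diff_cst.
apply: DiffDef; first exact: differentiable_coord.
have @f : {linear 'rV[K]_n -> K}.
  by exists (fun N : 'rV[K]_n => N 0 j'); do 2![eexists]; do ?[constructor];
     rewrite ?mxE// => ? *; rewrite ?mxE//; move=> ?; rewrite !mxE.
rewrite (_ : (fun _ => _) = f) // diff_lin //; exact: coord_continuous.
Qed.

(** Differentiability comes from the decomposition of row vectors along the
    standard basis, the value from the chain rule for the coordinate functions. *)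
Lemma diff_rowE p q (f : 'rV[K]_p -> 'rV[K]_q) (z : 'rV[K]_p)
    (df : 'I_q -> 'rV[K]_p -> K) :
  (forall i, is_diff z (fun x => f x 0 i : K) (df i)) ->
  forall v i, 'd f z v 0 i = df i v.
Proof.
move=> dfi v i.
have df_z : differentiable f z.
  have -> : f = \sum_(j < q) (fun x => f x 0 j *: delta_mx 0 j).
    by apply/funext => x; rewrite fct_sumE [LHS]row_sum_delta.
  by apply: differentiable_sum => j; apply: differentiableZl; case: (dfi j).
have dc := differentiable_coord (f z) 0 i.
have [_ cE] := dfi i.
have := diff_comp df_z dc.
rewrite (_ : _ \o f = fun x => f x 0 i) // cE => /(congr1 (@^~ v)) -> /=.
have -> : (fun N : 'rV[K]_q => N 0 i) = (fun N => xcoord N i.+1).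
  by apply/funext => N /=; rewrite valK.
have [_ ->] := is_diff_xcoord (f z) i.+1.
by rewrite /= valK.
Qed.

Lemma jacobian_coord p (f : 'rV[K]_p -> 'rV[K]_p) (z v : 'rV[K]_p) (mu : K)
    (df : 'I_p -> 'rV[K]_p -> K) :
  (forall i, is_diff z (fun x => f x 0 i : K) (df i)) ->
  v *m 'J f z = mu *: v -> forall i, mu * v 0 i = df i v.
Proof.
move=> dfi vJ i; rewrite -(diff_rowE dfi).
move/(congr1 (fun N : 'rV[K]_p => N 0 i)): vJ.
by rewrite /jacobian mul_rV_lin1 !mxE => ->.
Qed.

Lemma xcoord_ord n (x : 'rV[K]_n) (i : 'I_n) : xcoord x i.+1 = x 0 i.
Proof. by rewrite /= valK. Qed.

Lemma xcoord_out n (x : 'rV[K]_n) i : (n < i)%N -> xcoord x i = 0.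
Proof. by case: i => [//|i]; rewrite ltnS /= => ni; rewrite insubN // -leqNgt. Qed.

Variables (d : nat) (beta mu : K) (m : nat).
Hypothesis d0 : (0 < d)%N.

Lemma jacobian_koch0 (z v : 'rV[K]_(0 + m - 1)) (i : 'I_(0 + m - 1)) :
  v *m 'J (@koch K d beta 0 m) z = mu *: v ->
  mu * xcoord v i.+1 = d%:R * xcoord z i ^+ d.-1 * xcoord v i -
    d%:R * xcoord z (m - 1) ^+ d.-1 * xcoord v (m - 1).
Proof.
move=> vJ; rewrite xcoord_ord.
rewrite (jacobian_coord (df := fun i v => d%:R * xcoord z i ^+ d.-1 * xcoord v i -
  d%:R * xcoord z (m - 1) ^+ d.-1 * xcoord v (m - 1)) _ vJ) // => {}i.
rewrite (_ : (fun x => _) = (fun x => xcoord x i) ^+ d.-1.+1 -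
    (fun x => xcoord x (m - 1)) ^+ d.-1.+1); last first.
  by rewrite prednK //; apply/funext => x; rewrite mxE !fctE.
have := is_diff_xcoord z (m - 1); have := is_diff_xcoord z i => di dm.
by apply: is_diff_eq; rewrite prednK.
Qed.

(** The critical point of the polynomial attached to a point of the space. *)
Definition koch_center k (x : 'rV[K]_(k + m - 1)) : K :=
  (beta * xcoord x (k + m - 1) - xcoord x (k - 1)) / (beta - 1).

Lemma is_diff_koch_center k (z : 'rV[K]_(k + m - 1)) :
  is_diff z (@koch_center k : _ -> K) (@koch_center k).
Proof.
have := is_diff_xcoord z (k + m - 1); have := is_diff_xcoord z (k - 1) => di dm.
rewrite (_ : @koch_center k = (beta - 1)^-1 *:
  (beta *: (fun x => xcoord x (k + m - 1)) - (fun x => xcoord x (k - 1)))); last first.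
  by apply/funext => x; rewrite !fctE /= /koch_center mulrC.
exact: is_diff_eq.
Qed.

Lemma jacobian_koch k (z v : 'rV[K]_(k.+1 + m - 1)) (i : 'I_(k.+1 + m - 1)) :
  v *m 'J (@koch K d beta k.+1 m) z = mu *: v ->
  mu * xcoord v i.+1 = d%:R * (xcoord z i - koch_center z) ^+ d.-1 *
    (xcoord v i - koch_center v).
Proof.
move=> vJ; rewrite xcoord_ord.
rewrite (jacobian_coord (df := fun i v => d%:R *
  (xcoord z i - koch_center z) ^+ d.-1 * (xcoord v i - koch_center v)) _ vJ) // => {}i.
rewrite (_ : (fun x => _) = ((fun x => xcoord x i) - @koch_center k.+1) ^+ d.-1.+1);
  last by rewrite prednK //; apply/funext => x; rewrite mxE !fctE.
have di := is_diff_xcoord z i; have dc := is_diff_koch_center z.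
by apply: is_diff_eq; rewrite prednK.
Qed.

End Differential.

(** * Eigenvectors as marked critical orbits *)

Section Reduction.
Variable R : realType.
Local Notation C := R[i].
Variables (d : nat) (beta mu : C) (k m : nat) (u w : nat -> C).
Hypotheses (d2 : (1 < d)%N) (m0 : (0 < m)%N).
Hypotheses (betad : beta ^+ d = 1) (beta1 : beta != 1) (mu0 : mu != 0).
Hypotheses (u0 : u 0%N = 0) (w0 : w 0%N = 0)
  (uS : forall i, (i < k + m)%N -> u i.+1 = u i ^+ d + u 1%N)
  (wS : forall i, (i < k + m)%N -> mu * (w i.+1 - w 1%N) = d%:R * u i ^+ d.-1 * w i)
  (uk : u k = beta * u (k + m)%N) (wk : w k = beta * w (k + m)%N)
  (wneq0 : exists2 i, (i <= k + m)%N & w i != 0).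

Lemma marked_orbit_expanding : 1 < absc mu.
Proof.
have wE i : (i < k + m)%N -> w i.+1 = w 1%N + d%:R * u i ^+ d.-1 * w i / mu.
  by move=> ikm; rewrite -wS // [mu * _]mulrC mulfK // addrCA subrr addr0.
have w1 : w 1%N != 0.
  have [i ikm] := wneq0; apply: contra_neq => w1.
  elim: i ikm => [//|i IH] ikm; rewrite wE // IH ?w1; last exact: ltnW.
  by rewrite mulr0 mul0r addr0.
pose P := tangent_orbit d (u 1%N) (w 1%N) mu.
have PE i : (i <= k + m)%N -> P i = (u i, w i).
  elim: i => [|i IH] ikm; first by rewrite u0 w0.
  by rewrite /P tangent_orbitS -/P IH 1?ltnW // /tangent_step /= -uS // -wE.
have closing : P k = (beta * (P (k + m)%N).1, beta * (P (k + m)%N).2).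
  by rewrite !PE ?leq_addr //= -uk -wk.
have P1 : P 1%N = (u 1%N, w 1%N) by rewrite PE // addn_gt0 m0 orbT.
have le1 := tangent_orbit_expanding d2 mu0 m0 betad beta1 closing w1.
rewrite lt_neqAle le1 andbT; apply/eqP => /esym amu.
apply: (@unimodular_absurd _ d beta mu k m (fun i => (P i).1)
  (fun i => (P i).2 / w 1%N)) => //=.
- by move=> i; rewrite expr0n gtn_eqF ?(ltnW d2) // add0r.
- by rewrite closing.
- by rewrite mul0r.
- by move=> i; rewrite mulrDl divff //; congr (_ + _); rewrite mulrAC !mulrA.
- by rewrite closing mulrA.
Qed.

End Reduction.

Section Koch.
Variable R : realType.
Local Notation C := R[i].
Variables (d : nat) (beta mu : C) (m : nat).
Hypotheses (d2 : (1 < d)%N) (m0 : (0 < m)%N).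
Hypotheses (betad : beta ^+ d = 1) (beta1 : beta != 1) (mu0 : mu != 0).

(** For [k = 0] the critical point already is the origin, and the coordinates
    themselves form the critical orbit. The point of index [m] that closes it is 0,
    which is also the value of [xcoord] at this index, just out of range. *)
Lemma koch0_expanding (z v : 'rV[C]_(0 + m - 1)) : koch d beta z = z ->
  v != 0 -> v *m 'J (@koch _ d beta 0 m) z = mu *: v -> 1 < absc mu.
Proof.
move=> zfix v0 vJ; have d0 := ltnW d2.
have d00 : 0 ^+ d = 0 :> C by rewrite expr0n gtn_eqF.
have zS (i : 'I_(0 + m - 1)) :
    xcoord z i.+1 = xcoord z i ^+ d - xcoord z (m - 1) ^+ d.
  by rewrite xcoord_ord -{1}zfix mxE.
have vS (i : 'I_(0 + m - 1)) : mu * xcoord v i.+1 =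
    d%:R * xcoord z i ^+ d.-1 * xcoord v i -
    d%:R * xcoord z (m - 1) ^+ d.-1 * xcoord v (m - 1).
  exact: (@jacobian_koch0 _ d beta mu m d0 z v i vJ).
have xm (x : 'rV[C]_(0 + m - 1)) : xcoord x m = 0.
  by apply: xcoord_out; lia.
have orbit_last : 0 = xcoord z (m - 1) ^+ d + xcoord z 1 /\
    mu * (0 - xcoord v 1) = d%:R * xcoord z (m - 1) ^+ d.-1 * xcoord v (m - 1).
  have [m1|m1] := leqP m 1.
    (* the index also occurs in the type of [z]: rewrite by congruence *)
    have m10 : (m - 1 = 0)%N by lia.
    rewrite !(congr1 (xcoord _) m10) ![xcoord _ 1]xcoord_out; [|by lia|by lia].
    by rewrite d00 addr0 subr0 !mulr0.
  have i0 : (0 < 0 + m - 1)%N by lia.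
  have z1 : xcoord z 1 = 0 ^+ d - xcoord z (m - 1) ^+ d := zS (Ordinal i0).
  have v1 : mu * xcoord v 1 = d%:R * 0 ^+ d.-1 * 0 -
    d%:R * xcoord z (m - 1) ^+ d.-1 * xcoord v (m - 1) := vS (Ordinal i0).
  by rewrite z1 d00 !sub0r addrN mulrN v1 mulr0 sub0r opprK.
have mE : ((m - 1).+1 = m)%N by rewrite subn1 prednK.
have xS i : (i < 0 + m)%N -> i.+1 = m \/ (i < 0 + m - 1)%N by lia.
apply: (@marked_orbit_expanding _ d beta mu 0 m (xcoord z) (xcoord v)) => //.
- move=> i /xS [im|im]; last first.
    rewrite (zS (Ordinal im)); case: orbit_last => /esym/eqP.
    by rewrite addrC addr_eq0 => /eqP -> _.
  have -> : i = (m - 1)%N by lia.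
  by rewrite (congr1 (xcoord _) mE) xm; case: orbit_last.
- move=> i /xS [im|im]; last first.
    rewrite mulrBr (vS (Ordinal im)); case: orbit_last => _.
    by rewrite sub0r mulrN => /eqP; rewrite eqr_oppLR => /eqP ->; ring.
  have -> : i = (m - 1)%N by lia.
  by rewrite (congr1 (xcoord _) mE) xm; case: orbit_last.
- by rewrite [xcoord z (0 + m)]xm mulr0.
- by rewrite [xcoord v (0 + m)]xm mulr0.
- have /rV0Pn [i vi] := v0; exists i.+1; first by have := ltn_ord i; lia.
  by rewrite xcoord_ord.
Qed.

(** For [k > 0] the coordinates are the images of the critical point, so the
    orbit is shifted by one index; subtracting the critical point, and its variation
    along [v], puts the origin of the orbit at 0. *)
Lemma koch_expanding k (z v : 'rV[C]_(k.+1 + m - 1)) : koch d beta z = z ->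
  v != 0 -> v *m 'J (@koch _ d beta k.+1 m) z = mu *: v -> 1 < absc mu.
Proof.
move=> zfix v0 vJ; have d0 := ltnW d2.
have d00 : 0 ^+ d = 0 :> C by rewrite expr0n gtn_eqF.
pose a := @koch_center _ beta m k.+1.
have b1 : beta - 1 != 0 by rewrite subr_eq0.
have aE x : xcoord x k - a x = beta * (xcoord x (k + m) - a x).
  have e1 : (k.+1 + m - 1 = k + m)%N by rewrite addSn subn1.
  have e2 : (k.+1 - 1 = k)%N by rewrite subn1.
  by rewrite /a /koch_center (congr1 (xcoord x) e1) (congr1 (xcoord x) e2); field.
have zS (i : 'I_(k.+1 + m - 1)) : xcoord z i.+1 = (xcoord z i - a z) ^+ d.
  by rewrite xcoord_ord -{1}zfix mxE.
have vS (i : 'I_(k.+1 + m - 1)) : mu * xcoord v i.+1 =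
    d%:R * (xcoord z i - a z) ^+ d.-1 * (xcoord v i - a v).
  exact: jacobian_koch.
(* with [xcoord z 0 = 0] this gives [u 1 = - a z] *)
pose u i := if i is j.+1 then xcoord z j - a z else 0.
pose w i := if i is j.+1 then xcoord v j - a v else 0.
apply: (@marked_orbit_expanding _ d beta mu k.+1 m u w) => //.
- case=> [|i] ikm; first by rewrite /u /= d00 !add0r.
  have i' : (i < k.+1 + m - 1)%N by lia.
  by rewrite /u (zS (Ordinal i')) /= sub0r.
- case=> [|i] ikm; first by rewrite /w subrr !mulr0.
  have i' : (i < k.+1 + m - 1)%N by lia.
  have -> : w i.+2 - w 1%N = xcoord v i.+1 by rewrite /w /=; ring.
  by rewrite (vS (Ordinal i')).
- by rewrite addSn /u /= aE.
- by rewrite addSn /w /= aE.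
- have [av|av] := eqVneq (a v) 0; last first.
    by exists 1%N; rewrite ?addSn // /w /= sub0r oppr_eq0.
  have /rV0Pn [i vi] := v0; exists i.+2; first by have := ltn_ord i; lia.
  by rewrite /w xcoord_ord av subr0.
Qed.

End Koch.

Unset Implicit Arguments.

Theorem theorem1 (R : realType) (d : nat) (hd : (2 <= d)%N)
    (beta : R[i]) (hbeta : beta ^+ d = 1) (hbeta1 : beta <> 1)
    (k m : nat) (hm : (1 <= m)%N)
    (z : 'rV[R[i]]_(k + m - 1)) (hz : koch d beta z = z)
    (mu : R[i]) (hmu : eigenvalue ('J (@koch R[i] d beta k m) z) mu) :
  mu = 0 \/ 1 < `|mu|.
Proof.
have [->|mu0] := eqVneq mu 0; [by left|right].
have [v vJ v0] := eigenvalueP hmu.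
suff : 1 < absc mu by rewrite -ltcR -abscE rmorph1.
move/eqP: hbeta1 => hbeta1; case: k z hz {hmu} v vJ v0 => [|k] z hz v vJ v0.
  exact: koch0_expanding hd hm hbeta hbeta1 mu0 _ _ hz v0 vJ.
exact: koch_expanding hd hm hbeta hbeta1 mu0 _ _ _ hz v0 vJ.
Qed.
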